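(* Let $a\in\mathbb C$, put $r=|a|/2$, and let $A=F_{aI}=\begin{bmatrix} S^* & aI\\ 0 & S\end{bmatrix}$ acting on $\mathcal H\oplus\mathcal H$. Identify $\mathbb C$ with $\mathbb R^2$ via $x+iy\leftrightarrow (x,y)$. Then the numerical range $W(A)$ is symmetric with respect to both coordinate axes. It is bounded on the right and on the left by arcs of the circles of radius $r$ centered at $(1,0)$ and at $(-1,0)$, respectively, and from above and from below by arcs of the algebraic curve defined, in terms of $u=x^2$, $v=y^2$, by the equation $$\begin{gathered} 16 r^6 (u+v)^2-8 r^4 \left(u^3+(v-1)(4 u^2+5uv-u+2v^2)-v\right)\\ +r^2 \Big(\big((u-20) u-8\big) v^2+2 \big((u-15) u-4\big) (u-1) v+\big((u-10) u+1\big) (u-1)^2\Big)\\ +(u-1)^3 (u+v-1) = 0 . \end{gathered}$$ The points of the boundary of $W(A)$ at which these arcs switch from one type to the other are located on the supporting lines of $W(A)$ forming the angles $\pm\cos^{-1}\frac{\sqrt{4+r^2}-r}{2}$ with the $y$-axis.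
   Context: $\mathcal H$ is a Hilbert space and $S$ is the (unilateral) right shift on $\mathcal H$, i.e. $Se_n=e_{n+1}$ for an orthonormal basis $(e_n)_{n\ge 0}$ of $\mathcal H$; $S^*$ is its adjoint and $I$ the identity. For a bounded linear operator $T$ on $\mathcal H$, the Foguel operator is $F_T=\begin{bmatrix} S^* & T\\ 0& S\end{bmatrix}$ on $\mathcal H\oplus\mathcal H$. The numerical range of a bounded linear operator $A$ on a Hilbert space is $W(A)=\{\langle Ax,x\rangle: \|x\|=1\}$; it is a bounded convex subset of $\mathbb C$. For $\theta\in[-\pi,\pi]$ and $\omega=e^{i\theta}$, the supporting line of $W(A)$ with outward normal direction $\omega$ is $\omega\left(\lambda+i\mathbb R\right)$, where $\lambda=\sup\{\operatorname{Re}(\overline{\omega}z): z\in W(A)\}$. *)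

(* Defs.v *)
From HB Require Import structures.
From mathcomp Require Import all_boot all_order all_algebra.
From mathcomp Require Import complex sesquilinear.
From mathcomp Require Import all_classical all_reals all_analysis.

Set Implicit Arguments.
Unset Strict Implicit.
Unset Printing Implicit Defensive.

Import Order.TTheory GRing.Theory Num.Theory.
Import numFieldNormedType.Exports.

Local Open Scope classical_set_scope.
Local Open Scope ring_scope.
Local Open Scope complex_scope.

Section Operators.
Variable R : realType.
Local Notation C := R[i].

(* Inner products are linear in the first argument. A complex Hilbert space is
   a complete normed space whose norm is induced by an inner product. *)
Definition hilbert_norm (H : completeNormedModType C)
    (dot : {dot H for Num.conj}) : Prop :=
  forall x : H, `|x| ^+ 2 = dot x x.

Definition orthonormal_basis (H : completeNormedModType C)
    (dot : {dot H for Num.conj}) (e : nat -> H) : Prop :=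
  (forall m n, dot (e m) (e n) = (m == n)%:R) /\
  (forall x : H, (fun n => \sum_(i < n) dot x (e i) *: e i) @ \oo --> x).

Definition right_shift (H : completeNormedModType C) (e : nat -> H)
    (S : {linear H -> H}) : Prop :=
  continuous S /\ forall n, S (e n) = e n.+1.

Definition adjoint (H : completeNormedModType C) (dot : {dot H for Num.conj})
    (S S' : {linear H -> H}) : Prop :=
  forall x y, dot (S x) y = dot x (S' y).

(* The inner product of the Hilbert direct sum; the norm that the library puts
   on H * H is the max norm, which is not the Hilbert space norm. *)
Definition dot_sum (H : lmodType C) (dot : H -> H -> C) (p q : H * H) : C :=
  dot p.1 q.1 + dot p.2 q.2.

(* [[S', T], [0, S]] on H (+) H, where S' is meant to be the adjoint of S. *)
Definition foguel (H : lmodType C) (S' S T : H -> H) (p : H * H) : H * H :=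
  (S' p.1 + T p.2, S p.2).

(* The unit sphere is that of the norm induced by dot. *)
Definition numerical_range (V : lmodType C) (dot : V -> V -> C) (A : V -> V) :
    set C :=
  [set dot (A x) x | x in [set x : V | sqrtC (dot x x) = 1]].

(* The line is parallel to i e^{i theta}, so that theta is the (signed) angle
   from the y-axis to it. *)
Definition supporting_line (W : set C) (theta : R) : set C :=
  let omega : C := cos theta +i* sin theta in
  let lambda : R := sup [set complex.Re (Num.conj omega * z) | z in W] in
  [set omega * (lambda +i* t) | t in [set: R]].

(* The identification of C with R^2. *)
Definition planar (W : set C) : set (R * R) :=
  [set p | W (p.1 +i* p.2)].

End Operators.

Section PlaneGeometry.
Variable R : realType.
Implicit Types (W X : set (R * R)) (r : R).

Definition boundary W : set (R * R) := closure W `\` interior W.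

Definition symmetric_wrt_axes W : Prop :=
  (forall x y, W (x, y) -> W (x, - y)) /\ (forall x y, W (x, y) -> W (- x, y)).

Definition bounded_on_right W X : Prop :=
  forall p q, W p -> X q -> p.2 = q.2 -> p.1 <= q.1.
Definition bounded_on_left W X : Prop :=
  forall p q, W p -> X q -> p.2 = q.2 -> q.1 <= p.1.
Definition bounded_above W X : Prop :=
  forall p q, W p -> X q -> p.1 = q.1 -> p.2 <= q.2.
Definition bounded_below W X : Prop :=
  forall p q, W p -> X q -> p.1 = q.1 -> q.2 <= p.2.

Definition simple_closed_path (gamma : R -> R * R) : Prop :=
  [/\ {within `[0, 1], continuous gamma},
      gamma 0 = gamma 1 &
      {in `[0, 1[ &, injective gamma}].

Definition circle (c : R * R) r : set (R * R) :=
  [set p | (p.1 - c.1) ^+ 2 + (p.2 - c.2) ^+ 2 = r ^+ 2].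

Definition foguel_poly (r u v : R) : R :=
  16 * r ^+ 6 * (u + v) ^+ 2
  - 8 * r ^+ 4 *
      (u ^+ 3 + (v - 1) * (4 * u ^+ 2 + 5 * u * v - u + 2 * v ^+ 2) - v)
  + r ^+ 2 *
      (((u - 20) * u - 8) * v ^+ 2
       + 2 * ((u - 15) * u - 4) * (u - 1) * v
       + ((u - 10) * u + 1) * (u - 1) ^+ 2)
  + (u - 1) ^+ 3 * (u + v - 1).

Definition foguel_curve r : set (R * R) :=
  [set p | foguel_poly r (p.1 ^+ 2) (p.2 ^+ 2) = 0].

Definition switch_angle r : R := acos ((Num.sqrt (4 + r ^+ 2) - r) / 2).

End PlaneGeometry.

(* Main.v *)
Require Import Defs.
From HB Require Import structures.
From mathcomp Require Import all_boot all_order all_algebra.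
From mathcomp Require Import complex sesquilinear ring lra.
From mathcomp Require Import all_classical all_reals all_analysis.

(* Re(e^{-it}A) is a block Toeplitz operator whose 2x2 symbol has degree one. Let
   h(t) be the maximum of the largest eigenvalue of the symbol: |cos t| + r if
   sin^2 t <= r |cos t|, and sqrt(1 + r^2 / sin^2 t) otherwise. A Fejer-Riesz
   factorization of h(t) - Re(e^{-it}A) with an injective factor gives
   Re(e^{-it}z) < h(t) on W(A). Conversely, evaluating A at truncated geometric
   series sum_{i <= N} z^i e_i shows that W(A) contains every scaling by a factor
   < 1 of the numerical ranges of the values of the symbol of A, which are the
   ellipses with center (c, 0) and semi-axes r and sqrt(r^2 + 1 - c^2), where
   -1 <= c <= 1. The point at which the union of these ellipses is supported in
   direction t is a continuous function of t that traverses the whole boundary;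
   the disks c = 1 and c = -1 carry the caps, and for |c| < 1 one gets the curve
   dual to h(t) = sqrt(1 + r^2 / sin^2 t). So W(A) is exactly the open convex set
   with support function h, which is also the source of the symmetries. *)

Set Implicit Arguments.
Unset Strict Implicit.
Unset Printing Implicit Defensive.

Import Order.TTheory GRing.Theory Num.Theory.
Import numFieldNormedType.Exports.

Local Open Scope classical_set_scope.
Local Open Scope ring_scope.

(** * The Hermitian part of the Foguel operator *)

Section Form.
Variables (C : numClosedFieldType) (U : lmodType C).
Variable dot : {dot U for Num.conj}.

Lemma dotC x y : dot x y = (dot y x)^*.
Proof. by rewrite hermC expr0 mul1r. Qed.
Lemma dotDl x y z : dot (x + y) z = dot x z + dot y z.
Proof. exact: linearDl. Qed.
Lemma dotDr x y z : dot z (x + y) = dot z x + dot z y.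
Proof. exact: linearDr. Qed.
Lemma dotZl a x z : dot (a *: x) z = a * dot x z.
Proof. exact: linearZl_LR. Qed.
Lemma dotZr a x z : dot z (a *: x) = a^* * dot z x.
Proof. exact: linearZr_LR. Qed.
Lemma dotNl x z : dot (- x) z = - dot x z.
Proof. exact: linearNl. Qed.
Lemma dotNr x z : dot z (- x) = - dot z x.
Proof. exact: linearNr. Qed.
Definition dotE := (dotDl, dotDr, dotNl, dotNr, dotZl, dotZr).

(* [x'] and [y'] stand for S x and S y. Distributing the terms |x|^2, |y|^2 and
   <y, x> suitably over (x, y) and (x', y') turns Q into a Gram form whose block
   at (x', y') is [[lam, -mu], [-mu^*, lam]]; completing the square with respect
   to this block leaves lam (1 - 1/d) |x - y|^2 under the condition on mu. *)
Lemma toeplitz_form_ge0 x y x' y' (lam mu om r d : C) :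
  dot x' x' = dot x x -> dot y' y' = dot y y -> dot y' x' = dot y x ->
  0 < lam -> om * om^* = 1 -> r^* = r -> d = lam ^+ 2 - mu * mu^* -> 1 <= d ->
  (2 * r - mu) * d + om ^+ 2 * mu = lam * (d - 1) ->
  let Q := 2 * lam * (dot x x + dot y y)
     - (om * dot x' x + (om * dot x' x)^*)
     - (om^* * dot y' y + (om^* * dot y' y)^*)
     - 2 * r * (dot y x + (dot y x)^*) in
  0 <= Q /\ (Q = 0 -> d *: x' = (lam * om^*) *: x + (mu * om) *: y /\
                      d *: y' = (lam * om) *: y + (mu^* * om^*) *: x).
Proof.
move=> xx yy yx lam0 om1 rr dE d1 kap Q.
have d0 : 0 < d by apply: lt_le_trans d1.
have lamC : lam^* = lam by apply/geC0_conj/ltW.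
have dC : d^* = d by apply/geC0_conj/ltW.
have omN0 : om != 0.
  by apply: contra_eq_neq om1 => ->; rewrite mul0r eq_sym oner_neq0.
have omC : om^* = om^-1 by apply: (mulfI omN0); rewrite om1 mulfV.
pose u := (lam * om^*) *: x + (mu * om) *: y.
pose w := (lam * om) *: y + (mu^* * om^*) *: x.
pose h1 := d *: x' - u.
pose h2 := d *: y' - w.
have kapC := congr1 Num.conj kap.
move: kapC.
rewrite !(rmorphD, rmorphM, rmorphB, rmorphXn, rmorph1, rmorphN, rmorph_nat) /=.
rewrite !(lamC, dC, rr) => kapC.
have key : d ^+ 2 * lam * Q =
   dot (lam *: h1 - mu *: h2) (lam *: h1 - mu *: h2) + d * dot h2 h2
   + d * lam ^+ 2 * (d - 1) * dot (x - y) (x - y).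
  have E1 : 2 * r * d = lam * (d - 1) + mu * d - om ^+ 2 * mu.
    by rewrite -kap; ring.
  have E2 : 2 * r * d = lam * (d - 1) + mu^* * d - om^* ^+ 2 * mu^*.
    by rewrite -kapC; ring.
  have xy : dot x' y' = dot x y by rewrite dotC yx -dotC.
  have -> : d ^+ 2 * lam * Q = d ^+ 2 * lam * (2 * lam * (dot x x + dot y y)
     - (om * dot x' x + om^* * dot x x') - (om^* * dot y' y + om * dot y y'))
     - d * lam * (2 * r * d) * dot y x - d * lam * (2 * r * d) * dot x y.
    by rewrite /Q !rmorphM /= conjCK -!dotC; ring.
  rewrite {1}E1 E2 /h1 /h2 /u /w !dotE !rmorphM /= !conjCK !(lamC, dC).
  rewrite xx yy yx xy omC dE.
  field.
  exact: omN0.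
have hd : 0 < d ^+ 2 * lam by rewrite mulr_gt0 ?exprn_gt0.
have R1 : 0 <= dot (lam *: h1 - mu *: h2) (lam *: h1 - mu *: h2) by exact: dnorm_ge0.
have R2 : 0 <= d * dot h2 h2 by rewrite mulr_ge0 ?dnorm_ge0 ?ltW.
have R3 : 0 <= d * lam ^+ 2 * (d - 1) * dot (x - y) (x - y).
  by rewrite !mulr_ge0 ?dnorm_ge0 ?exprn_ge0 ?subr_ge0 // ltW.
split; first by rewrite -(pmulr_rge0 _ hd) key !addr_ge0.
move=> Q0; move: key; rewrite Q0 mulr0 => /esym/eqP.
rewrite !paddr_eq0 ?addr_ge0 // => /andP[/andP[]]; rewrite dnorm_eq0 => /eqP n1.
rewrite mulf_eq0 gt_eqF //= dnorm_eq0 => /eqP h20 _.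
move: n1; rewrite h20 scaler0 subr0 => /eqP; rewrite scaler_eq0 gt_eqF //= => /eqP h10.
by split; apply/eqP; rewrite -subr_eq0; apply/eqP.
Qed.

End Form.

Lemma normc_ge0 (R : rcfType) (a : R[i]) : 0 <= ComplexField.Normc.normc a.
Proof. by case: a => ? ?; exact: sqrtr_ge0. Qed.

(** Allows the argument of [a] to be absorbed into one component of a vector, so that only the
    modulus of [a] enters the numerical range. *)
Lemma normc_phase (R : rcfType) (a : R[i]) :
  exists2 u : R[i], u * u^* = 1 & a = (ComplexField.Normc.normc a)%:C%C * u.
Proof.
rewrite -[(ComplexField.Normc.normc a)%:C%C]/`|a|.
have [->|an0] := eqVneq a 0.
  by exists 1; rewrite ?rmorph1 ?mulr1 // normr0.
exists (a / `|a|); last by rewrite mulrC divfK ?normr_eq0.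
by rewrite -normCK normrM normfV normr_id divff ?normr_eq0 // expr1n.
Qed.

(* The vector (v1, v2) whose Bloch vector is (m, P, Q), up to a phase. *)
Lemma bloch_vector (R : rcfType) (a : R[i]) (m P Q : R) :
  m ^+ 2 + P ^+ 2 + Q ^+ 2 = 1 ->
  exists v1 v2 : R[i],
    [/\ v1 * v1^* = ((1 + m) / 2)%:C%C, v2 * v2^* = ((1 - m) / 2)%:C%C &
        a * v2 * v1^* = (ComplexField.Normc.normc a / 2)%:C%C * (P +i* Q)%C].
Proof.
move=> mPQ; have [u uu {1}->] := normc_phase a.
have [m1|m1] := eqVneq (1 + m) 0.
  have [-> -> ->] : [/\ m = -1, P = 0 & Q = 0].
    have mE : m = -1 by lra.
    have : P ^+ 2 + Q ^+ 2 = 0 by move: mPQ; rewrite mE; lra.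
    by move/eqP; rewrite paddr_eq0 ?sqr_ge0 // !sqrf_eq0 => /andP[/eqP-> /eqP->].
  exists 0, 1; rewrite rmorph0 rmorph1 !mulr0 mulr1 subrr mul0r; split => //.
  by rewrite opprK -[1 + 1]/(2%:R) divff ?pnatr_eq0.
have m_gt0 : 0 < 1 + m.
  rewrite lt_neqAle eq_sym m1 /=.
  have : m ^+ 2 <= 1 by rewrite -mPQ -addrA lerDl addr_ge0 ?sqr_ge0.
  nra.
pose k := Num.sqrt ((1 + m) / 2).
have k2 : k ^+ 2 = (1 + m) / 2 by rewrite sqr_sqrtr // divr_ge0 // ltW.
have k0 : k != 0 by rewrite gt_eqF // sqrtr_gt0 divr_gt0.
exists k%:C%C, (u^* * (P / (2 * k) +i* (Q / (2 * k)))%C).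
have kk : k * k = (1 + m) / 2 by rewrite -expr2.
rewrite [(k%:C%C)^*]conjc_real; split.
- by rewrite -rmorphM kk.
- rewrite rmorphM /= conjCK.
  set w := (_ +i* _)%C.
  transitivity (u * u^* * (w * w^*)); first by ring.
  rewrite uu mul1r; apply/eqP; rewrite eq_complex /=.
  apply/andP; split; apply/eqP; last by ring.
  transitivity ((1 - m ^+ 2) / (4 * k ^+ 2)); last by rewrite k2; field.
  have -> : 1 - m ^+ 2 = P ^+ 2 + Q ^+ 2 by rewrite -mPQ; ring.
  by field.
- set n := ComplexField.Normc.normc a.
  set w := (_ +i* (_ / _))%C.
  transitivity (u * u^* * (n%:C%C * w * k%:C%C)); first by ring.
  rewrite uu mul1r; apply/eqP; rewrite eq_complex /=.
  by apply/andP; split; apply/eqP; field.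
Qed.

(* The maximum over -1 <= c <= 1 of c cos t + sqrt(r^2 + (1 - c^2) sin^2 t), which
   is attained at c = 1 or c = -1 in the first case. For r >= 0 the second case
   entails sin t != 0. *)
Definition foguel_support (R : realType) (r t : R) : R :=
  if sin t ^+ 2 <= r * `|cos t| then `|cos t| + r
  else Num.sqrt (1 + r ^+ 2 / sin t ^+ 2).

(** * The shift in coordinates, and strict upper bounds for the numerical range *)

Section Shift.
Variables (R : realType) (H : completeNormedModType R[i]).
Variables (dot : {dot H for Num.conj}) (e : nat -> H).
Hypothesis e_basis : orthonormal_basis dot e.
Variables (S Sadj : {linear H -> H}).
Hypothesis S_shift : right_shift e S.
Hypothesis S_adj : adjoint dot S Sadj.

Lemma coord_inj x y : (forall n, dot x (e n) = dot y (e n)) -> x = y.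
Proof.
move=> xy; have [_ ex] := e_basis; have := ex y.
rewrite (_ : (fun n => _) = (fun n => \sum_(i < n) dot x (e i) *: e i)); last first.
  by apply/funext => n; apply: eq_bigr => i _; rewrite xy.
by move=> hy; apply: (norm_cvg_unique (ex x) hy).
Qed.

(** [Sadj (e 0)] is zero because its coordinates are inner products of [e 0] with the vectors
    [e n.+1]. *)
Lemma shift_coord0 x : dot (S x) (e 0%N) = 0.
Proof.
rewrite S_adj (_ : Sadj (e 0%N) = 0) ?linear0r //.
apply: coord_inj => n; rewrite linear0l dotC.
by rewrite -S_adj S_shift.2 e_basis.1 /= rmorph0.
Qed.

Lemma adj_shiftS n : Sadj (e n.+1) = e n.
Proof.
apply: coord_inj => m; rewrite dotC -S_adj S_shift.2 !e_basis.1 eqSS rmorph_nat.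
by rewrite eq_sym.
Qed.

Lemma shift_coordS x n : dot (S x) (e n.+1) = dot x (e n).
Proof. by rewrite S_adj adj_shiftS. Qed.

Lemma shift_isometry x y : dot (S x) (S y) = dot x y.
Proof.
rewrite S_adj; congr (dot x _); apply: coord_inj => n.
by rewrite dotC -S_adj S_shift.2 dotC conjCK shift_coordS.
Qed.

(** The source of strictness. The matrix on the right-hand sides has determinant [d], so the
    coordinates of [x] and [y] at [n] are determined by those of [S x] and [S y], which are the
    preceding ones of [x] and [y]. The induction starts from the vanishing coordinate 0 of a shifted
    vector. *)
Lemma shift_pair_inj (lam mu om d eps : R[i]) x y :
  d = lam ^+ 2 - mu * mu^* -> d != 0 -> om * om^* = 1 ->
  (d * eps) *: S x = (lam * om^*) *: x + (mu * om) *: y ->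
  (d * eps) *: S y = (lam * om) *: y + (mu^* * om^*) *: x ->
  x = 0 /\ y = 0.
Proof.
move=> dE dn0 om1 hx hy.
have step n : dot (S x) (e n) = 0 -> dot (S y) (e n) = 0 ->
    dot x (e n) = 0 /\ dot y (e n) = 0.
  move=> sx sy.
  have := congr1 (dot^~ (e n)) hx; rewrite !dotE sx mulr0 => /esym E1.
  have := congr1 (dot^~ (e n)) hy; rewrite !dotE sy mulr0 => /esym E2.
  split; apply: (mulfI dn0); rewrite mulr0.
    rewrite -[LHS]mulr1 -om1 dE.
    transitivity (lam * om * (lam * om^* * dot x (e n) + mu * om * dot y (e n))
      - mu * om * (lam * om * dot y (e n) + mu^* * om^* * dot x (e n))); first by ring.
    by rewrite E1 E2 !mulr0 subrr.
  rewrite -[LHS]mulr1 -om1 dE.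
  transitivity (lam * om^* * (lam * om * dot y (e n) + mu^* * om^* * dot x (e n))
     - mu^* * om^* * (lam * om^* * dot x (e n) + mu * om * dot y (e n))); first by ring.
  by rewrite E1 E2 !mulr0 subrr.
have {step} all n : dot x (e n) = 0 /\ dot y (e n) = 0.
  elim: n => [|n [IHx IHy]]; apply: step; rewrite ?shift_coord0 ?shift_coordS //.
by split; apply: coord_inj => n; rewrite linear0l; have [] := all n.
Qed.

(* [eps = -1] amounts to replacing S by the isometry -S; it is used for the
   directions pointing to the left. *)
Lemma toeplitz_form_lt (lam mu om r d eps : R[i]) x y :
  eps = 1 \/ eps = -1 ->
  0 < lam -> om * om^* = 1 -> r^* = r -> d = lam ^+ 2 - mu * mu^* -> 1 <= d ->
  (2 * r - mu) * d + om ^+ 2 * mu = lam * (d - 1) ->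
  dot x x + dot y y = 1 ->
  eps * om * dot (S x) x + (eps * om * dot (S x) x)^*
  + (eps * om^* * dot (S y) y + (eps * om^* * dot (S y) y)^*)
  + 2 * r * (dot y x + (dot y x)^*) < 2 * lam.
Proof.
move=> heps lam0 om1 rr dE d1 kap xy1.
have [epsC eps2] : eps^* = eps /\ eps * eps = 1.
  by case: heps => ->; rewrite ?rmorphN rmorph1 ?mulrNN mulr1.
have iso u v : dot (eps *: S u) (eps *: S v) = dot u v.
  by rewrite !dotE epsC mulrA eps2 mul1r shift_isometry.
have [] := toeplitz_form_ge0 (iso x x) (iso y y) (iso y x) lam0 om1 rr dE d1 kap.
rewrite xy1 mulr1 !dotE !mulrA ![om * eps]mulrC ![om^* * eps]mulrC.
rewrite -!addrA -!opprD !addrA; set T := (X in 2 * lam - X).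
rewrite subr_ge0 le_eqVlt => /orP[/eqP TE|//].
have dn0 : d != 0 by rewrite gt_eqF // (lt_le_trans _ d1).
rewrite TE subrr => /(_ erefl)[]; rewrite !scalerA => hx hy.
have [x0 y0] := shift_pair_inj dE dn0 om1 hx hy.
by move: xy1; rewrite x0 y0 !linear0l addr0 => /eqP; rewrite eq_sym oner_eq0.
Qed.

Lemma Re_lt (w : R[i]) (lam : R) : w + w^* < 2 * lam%:C%C -> complex.Re w < lam.
Proof.
case: w => p q; rewrite -[2](rmorph_nat (real_complex R)) -rmorphM /= ltcE /=.
move=> /andP[_]; lra.
Qed.

(** With [a = 2 r u], rotating [y] by the unimodular [c], the product of [u] and the conjugate of
    [eps * om], makes the coupling coefficient real and leads back to [toeplitz_form_lt]. *)
Lemma foguel_Re_lt (lam r : R) (mu om d eps a : R[i]) x y :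
  eps = 1 \/ eps = -1 ->
  0 < lam -> om * om^* = 1 -> d = lam%:C%C ^+ 2 - mu * mu^* -> 1 <= d ->
  (2 * r%:C%C - mu) * d + om ^+ 2 * mu = lam%:C%C * (d - 1) ->
  dot x x + dot y y = 1 -> r = ComplexField.Normc.normc a / 2 ->
  complex.Re ((eps * om)^* * (dot (Sadj x + a *: y) x + dot (S y) y)) < lam.
Proof.
move=> heps lam0 om1 dE d1 kap xy1 rE.
have rr : (r%:C%C : R[i])^* = r%:C%C by exact: conjc_real.
have [u uu aE] : exists2 u : R[i], u * u^* = 1 & a = 2 * r%:C%C * u.
  have [u uu ->] := normc_phase a; exists u => //; congr (_ * _).
  by rewrite -[2](rmorph_nat (real_complex R)) -rmorphM rE mulrC divfK ?pnatr_eq0.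
have [epsC eps2] : eps^* = eps /\ eps * eps = 1.
  by case: heps => ->; rewrite ?rmorphN rmorph1 ?mulrNN mulr1.
pose c := (eps * om)^* * u.
have cc : c * c^* = 1.
  rewrite /c !rmorphM /= !conjCK !epsC.
  transitivity ((eps * eps) * (om * om^*) * (u * u^*)); first by ring.
  by rewrite eps2 om1 uu !mulr1.
have cyy : dot (c *: y) (c *: y) = dot y y by rewrite !dotE mulrA cc mul1r.
apply: Re_lt.
have lam0C : 0 < lam%:C%C by rewrite ltcR.
have := @toeplitz_form_lt _ mu _ _ d eps x (c *: y) heps lam0C om1 rr dE d1 kap.
rewrite cyy => /(_ xy1); congr (_ < _).
have -> : S (c *: y) = c *: S y by rewrite linearZ.
rewrite !dotE; set p := dot (S x) x; set q := dot (S y) y.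
have -> : dot (Sadj x) x = p^* by rewrite dotC /p S_adj.
have -> : eps * om^* * (c * (c^* * q)) = eps * om^* * q.
  transitivity (eps * om^* * (c * c^*) * q); first by ring.
  by rewrite cc mulr1.
rewrite aE /c !(rmorphM, rmorphD, conjCK, rmorph_nat) /= !conjCK !epsC rr.
by ring.
Qed.

(* mu = r + i s: at z = 1 the symbol has the eigenvector (1, 1) for C + r. *)
Lemma foguel_cap_lt (C s r : R) (eps a : R[i]) x y :
  eps = 1 \/ eps = -1 -> C ^+ 2 + s ^+ 2 = 1 -> 0 <= C -> s ^+ 2 <= r * C ->
  dot x x + dot y y = 1 -> r = ComplexField.Normc.normc a / 2 ->
  complex.Re ((eps * (C +i* s)%C)^* * (dot (Sadj x + a *: y) x + dot (S y) y))
    < C + r.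
Proof.
move=> heps cs C0 sC xy1 rE.
have r0 : 0 <= r by rewrite rE divr_ge0 // normc_ge0.
have Cgt0 : 0 < C.
  rewrite lt_neqAle C0 andbT; apply/eqP => C00.
  by move: cs sC; rewrite -C00 mulr0 expr0n add0r => ->; rewrite ler10.
have sE : s ^+ 2 = 1 - C ^+ 2 by lra.
apply: (@foguel_Re_lt (C + r) r (r +i* s)%C (C +i* s)%C
  (C ^+ 2 + 2 * r * C - s ^+ 2)%:C%C) => //; first lra.
- by apply/eqP; rewrite eq_complex /=; apply/andP; split; apply/eqP; lra.
- by apply/eqP; rewrite eq_complex /=; apply/andP; split; apply/eqP; ring.
(* Here [d - 1 = 2 (r C - s^2)], so the cap condition is exactly [1 <= d]. *)
- rewrite lecR; nra.
- rewrite -[2](rmorph_nat (real_complex R)); apply/eqP.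
  rewrite eq_complex /= !(mul0r, mul1r, subr0, add0r, addr0).
  apply/andP; split; apply/eqP; last by ring.
  apply/eqP; rewrite -subr_eq0; apply/eqP.
  by transitivity ((C + r) * (1 - (C ^+ 2 + s ^+ 2))); [ring|rewrite cs subrr mulr0].
Qed.

(* mu = i r conj(om) / s: with d = 1 the condition on mu is linear. *)
Lemma foguel_top_lt (C s r : R) (a : R[i]) x y :
  C ^+ 2 + s ^+ 2 = 1 -> s != 0 ->
  dot x x + dot y y = 1 -> r = ComplexField.Normc.normc a / 2 ->
  complex.Re ((C +i* s)%C^* * (dot (Sadj x + a *: y) x + dot (S y) y))
    < Num.sqrt (1 + r ^+ 2 / s ^+ 2).
Proof.
move=> cs s0 xy1 rE.
set lam := Num.sqrt _.
have lam2 : lam ^+ 2 = 1 + r ^+ 2 / s ^+ 2.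
  by rewrite sqr_sqrtr // addr_ge0 // divr_ge0 // sqr_ge0.
have lam0 : 0 < lam by rewrite sqrtr_gt0 ltr_pwDl // divr_ge0 // sqr_ge0.
have -> : ((C +i* s)%C : R[i]) = 1 * (C +i* s)%C by rewrite mul1r.
apply: (@foguel_Re_lt lam r (r +i* (r * C / s))%C (C +i* s)%C 1) => //.
- by left.
- by apply/eqP; rewrite eq_complex /=; apply/andP; split; apply/eqP; lra.
- apply/eqP; rewrite eq_complex /=; apply/andP; split; apply/eqP; last by ring.
  have -> : lam * lam = 1 + r ^+ 2 * (C ^+ 2 + s ^+ 2) / s ^+ 2.
    by rewrite -expr2 lam2 cs mulr1.
  by field.
- rewrite subrr mulr0 mulr1 -[2](rmorph_nat (real_complex R)); apply/eqP.
  rewrite eq_complex /= !(mul0r, mul1r, subr0, add0r, addr0).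
  apply/andP; split; apply/eqP.
    apply/eqP; rewrite -subr_eq0; apply/eqP.
    transitivity (r * (1 - (C ^+ 2 + s ^+ 2))); last by rewrite cs subrr mulr0.
    by field.
  apply/eqP; rewrite -subr_eq0; apply/eqP.
  transitivity (r * C / s * (C ^+ 2 + s ^+ 2 - 1)); last by rewrite cs subrr mulr0.
  by field.
Qed.

Lemma numerical_range_lt (a : R[i]) (p : R * R) :
  let r := ComplexField.Normc.normc a / 2 in
  planar (numerical_range (dot_sum dot) (foguel Sadj S (fun x => a *: x))) p ->
  forall t, p.1 * cos t + p.2 * sin t < foguel_support r t.
Proof.
move=> r [[x y] /= n1 zE] t.
have {}n1 : dot x x + dot y y = 1.
  by rewrite -[LHS]sqrtCK -[X in X ^+ 2]/(sqrtC (dot_sum dot (x, y) (x, y))) n1 expr1n.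
have -> : p.1 * cos t + p.2 * sin t
    = complex.Re ((cos t +i* sin t)%C^* * (p.1 +i* p.2)%C) by rewrite /=; ring.
rewrite -zE /dot_sum /foguel /= /foguel_support.
have cs := cos2Dsin2 t.
case: ifPn => [cap|top]; last first.
  apply: foguel_top_lt => //.
  by apply: contraNneq top => ->; rewrite expr0n mulr_ge0 // divr_ge0 // normc_ge0.
have [C0|C0] := ger0P (cos t).
  rewrite -[(_ +i* _)%C]mul1r; apply: foguel_cap_lt => //; first by left.
  by move: cap; rewrite ger0_norm.
(* A direction pointing to the left is the opposite of one pointing to the right; the sign is passed
   to [eps]. *)
have -> : ((cos t +i* sin t)%C : R[i]) = (-1) * (- cos t +i* - sin t)%C.
  by apply/eqP; rewrite eq_complex /=; apply/andP; split; apply/eqP; ring.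
apply: foguel_cap_lt => //; first by right.
- by rewrite !sqrrN.
- by rewrite oppr_ge0 ltW.
- by move: cap; rewrite sqrrN ltr0_norm.
Qed.

(** * Values at geometric series *)

Let G (z : R[i]) n := \sum_(i < n) z ^+ i *: e i.

Let GS z n : G z n.+1 = G z n + z ^+ n *: e n.
Proof. by rewrite /G big_ord_recr. Qed.

Lemma dot_geom_e z n m : dot (G z n) (e m) = (m < n)%N%:R * z ^+ m.
Proof.
elim: n => [|n IH]; first by rewrite /G big_ord0 linear0l mul0r.
rewrite GS !dotE IH e_basis.1 ltnS [(m <= n)%N]leq_eqVlt [n == m]eq_sym.
by case: eqVneq => [->|]; rewrite ?ltnn /= ?mul0r ?mulr0 ?mulr1 ?mul1r ?add0r ?addr0.
Qed.

Lemma dot_geom_geom z n : z * z^* = 1 -> dot (G z n) (G z n) = n%:R.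
Proof.
move=> zz; elim: n => [|n IH]; first by rewrite /G big_ord0 linear0l.
rewrite GS !dotE IH [dot (e n) (G z n)]dotC dot_geom_e ltnn mul0r rmorph0 !mulr0.
by rewrite addr0 add0r e_basis.1 eqxx mulr1 rmorphXn /= -exprMn zz expr1n -natr1.
Qed.

(** The shift moves [n.+1] coefficients up by one place, so only [n] of them meet the original ones.
    Against the squared norm [n.+1] this leaves the factor [n / n.+1]. *)
Lemma dot_shift_geom z n : z * z^* = 1 ->
  dot (S (G z n.+1)) (G z n.+1) = n%:R * z^*.
Proof.
move=> zz; elim: n => [|n IH].
  rewrite /G big_ord1 expr0 scale1r S_shift.2 e_basis.1 mul0r //.
have -> : S (G z n.+2) = S (G z n.+1) + z ^+ n.+1 *: e n.+2.
  by rewrite GS linearD linearZ /= S_shift.2.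
rewrite [in X in dot _ X]GS !dotE IH.
rewrite [dot (e _) (G _ _)]dotC dot_geom_e ltnNge leqnSn mul0r rmorph0 !e_basis.1.
rewrite shift_coordS dot_geom_e ltnSn mul1r.
rewrite -[(n.+2 == n.+1)%:R]/((n.+2 == n.+1)%N%:R) eqn_leq ltnn /=.
rewrite !mulr0 !addr0 rmorphXn /=.
by rewrite exprS -mulrA -exprMn [z^* * z]mulrC zz expr1n mulr1 -natr1 mulrDl mul1r.
Qed.

(** Evaluates the operator at [(v1 g, v2 g)], where [g] is a normalized truncated series at
    [z = c + i s] and [(v1, v2)] has Bloch vector [(m, P, Q)]. The squared moduli of [v1] and [v2]
    have sum 1 and difference [m], whence the two terms with [rho]. *)
Lemma geom_value (a : R[i]) (n : nat) (c s m P Q : R) :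
  let r := ComplexField.Normc.normc a / 2 in
  let rho := n%:R / n.+1%:R in
  c ^+ 2 + s ^+ 2 = 1 -> m ^+ 2 + P ^+ 2 + Q ^+ 2 = 1 ->
  planar (numerical_range (dot_sum dot) (foguel Sadj S (fun x => a *: x)))
    (rho * c + r * P, rho * s * m + r * Q).
Proof.
move=> r rho cs mPQ.
have [v1 [v2 [v11 v22 v21]]] := bloch_vector a mPQ.
pose z : R[i] := (c +i* s)%C.
have zz : z * z^* = 1.
  by apply/eqP; rewrite eq_complex /=; apply/andP; split; apply/eqP; lra.
pose k : R := Num.sqrt (n.+1%:R^-1).
have kk : (k%:C%C * k%:C%C : R[i]) = (n.+1%:R^-1)%:C%C.
  by rewrite -rmorphM -expr2 sqr_sqrtr.
have n0 : (n.+1%:R : R) != 0 by rewrite pnatr_eq0.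
have n1C : (n.+1%:R : R[i]) = (n.+1%:R)%:C%C by rewrite rmorph_nat.
have nC : (n%:R : R[i]) = (n%:R)%:C%C by rewrite rmorph_nat.
have kC : ((k%:C%C)^* : R[i]) = k%:C%C by exact: conjc_real.
pose g := k%:C%C *: G z n.+1.
have gg : dot g g = 1.
  by rewrite !dotE kC dot_geom_geom // mulrA kk n1C -rmorphM mulVf.
have Sg : dot (S g) g = rho%:C%C * z^*.
  have -> : S g = k%:C%C *: S (G z n.+1) by rewrite linearZ.
  rewrite !dotE kC dot_shift_geom // !mulrA kk nC -rmorphM.
  by rewrite [n.+1%:R^-1 * _]mulrC.
have aSg : dot (Sadj g) g = rho%:C%C * z.
  by rewrite dotC -S_adj Sg rmorphM /= conjCK [(rho%:C%C)^*]conjc_real.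
move: g gg Sg aSg => g gg Sg aSg.
rewrite /planar /numerical_range /=; exists (v1 *: g, v2 *: g).
  rewrite /= /dot_sum /= !dotE gg !mulr1 v11 v22 -rmorphD.
  by rewrite -mulrDl addrACA subrr addr0 divff ?pnatr_eq0 // rmorph1 sqrtC1.
have -> : foguel Sadj S ( *:%R a) (v1 *: g, v2 *: g) =
    (v1 *: Sadj g + a *: (v2 *: g), v2 *: S g) by rewrite /foguel !linearZ.
rewrite /dot_sum /= !dotE gg Sg aSg mulr1.
transitivity ((v1 * v1^*) * (rho%:C%C * z) + (v2 * v2^*) * (rho%:C%C * z^*)
  + a * v2 * v1^*); first by ring.
rewrite v11 v22 v21 -/r; apply/eqP; rewrite eq_complex /=.
by apply/andP; split; apply/eqP; field.
Qed.

Lemma circle_meets_line (rs r p y : R) :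
  p ^+ 2 <= 1 -> y ^+ 2 <= (rs ^+ 2 + r ^+ 2) * (1 - p ^+ 2) ->
  exists m Q, m ^+ 2 + p ^+ 2 + Q ^+ 2 = 1 /\ rs * m + r * Q = y.
Proof.
move=> p1 hy; set L := rs ^+ 2 + r ^+ 2.
have [L0|L0] := eqVneq L 0.
  move: L0 hy => /eqP; rewrite /L paddr_eq0 ?sqr_ge0 // !sqrf_eq0.
  move=> /andP[/eqP -> /eqP ->].
  rewrite expr0n addr0 mul0r => y0; have -> : y = 0.
    by apply/eqP; rewrite -sqrf_eq0 eq_le y0 sqr_ge0.
  exists (Num.sqrt (1 - p ^+ 2)), 0.
  by rewrite sqr_sqrtr ?subr_ge0 // expr0n !mul0r !addr0 subrK.
pose w := Num.sqrt (L * (1 - p ^+ 2) - y ^+ 2).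
have ww : w ^+ 2 = L * (1 - p ^+ 2) - y ^+ 2 by rewrite sqr_sqrtr // subr_ge0.
(* The point [(m, Q)] is [y / L] times [(rs, r)] plus [w / L] times the orthogonal vector
   [(r, - rs)]; [w] adjusts its norm. *)
exists ((rs * y + r * w) / L), ((r * y - rs * w) / L); split; last first.
  by rewrite /L; field.
have -> : ((rs * y + r * w) / L) ^+ 2 + p ^+ 2 + ((r * y - rs * w) / L) ^+ 2 =
  p ^+ 2 + (y ^+ 2 + w ^+ 2) / L by rewrite /L; field.
by rewrite ww; field.
Qed.

(** The factor [tau < 1] leaves room for the loss [rho = n / n.+1]. Once [tau <= rho], the
    parameters are shrunk to [sg * c] and [tau * p] with [rho * sg = tau], and the ordinates
    available there include [tau * y]. *)
Lemma ellipse_sub_range (a : R[i]) (c p y tau : R) :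
  let r := ComplexField.Normc.normc a / 2 in
  c ^+ 2 <= 1 -> p ^+ 2 <= 1 -> y ^+ 2 <= (r ^+ 2 + 1 - c ^+ 2) * (1 - p ^+ 2) ->
  0 <= tau -> tau < 1 ->
  planar (numerical_range (dot_sum dot) (foguel Sadj S (fun x => a *: x)))
    (tau * (c + r * p), tau * y).
Proof.
move=> r c1 p1 hy t0 t1.
have [n hn] : exists n : nat, tau <= n%:R / n.+1%:R.
  have [n hn] : exists n : nat, tau / (1 - tau) <= n%:R.
    exists (Num.bound (tau / (1 - tau))).
    by rewrite ltW // archi_boundP // divr_ge0 // subr_ge0 ltW.
  exists n; rewrite ler_pdivlMr ?ltr0n // -natr1.
  move: hn; rewrite ler_pdivrMr ?subr_gt0 //; lra.
pose rho : R := n%:R / n.+1%:R; rewrite -/rho in hn.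
have rho0 : 0 <= rho by rewrite divr_ge0.
have rho1 : rho <= 1 by rewrite ler_pdivrMr ?ltr0n // mul1r ler_nat.
pose sg := tau / rho.
have sgE : rho * sg = tau.
  (* If [rho = 0] then [tau = 0], and [sg = 0] by the convention for division by zero. *)
  have [r0|r0] := eqVneq rho 0; last by rewrite mulrC divfK.
  by rewrite r0 mul0r; apply/eqP; rewrite eq_le t0 -r0 hn.
have sg0 : 0 <= sg by rewrite divr_ge0.
have sg1 : sg <= 1.
  have [r0|r0] := eqVneq rho 0; first by rewrite /sg r0 invr0 mulr0.
  by rewrite ler_pdivrMr ?mul1r // lt_neqAle eq_sym r0.
pose s := Num.sqrt (1 - (sg * c) ^+ 2).
have sgsq : sg ^+ 2 <= 1 by rewrite expr_le1.
have tsq : tau ^+ 2 <= rho ^+ 2 by rewrite lerXn2r.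
have tau2 : tau ^+ 2 <= 1 by rewrite expr_le1 // ltW.
have sc1 : (sg * c) ^+ 2 <= 1 by rewrite exprMn mulr_ile1 ?sqr_ge0.
have ss : s ^+ 2 = 1 - (sg * c) ^+ 2 by rewrite sqr_sqrtr // subr_ge0.
have tp1 : (tau * p) ^+ 2 <= 1 by rewrite exprMn mulr_ile1 ?sqr_ge0.
have [m [Q [mPQ QE]]] : exists m Q, m ^+ 2 + (tau * p) ^+ 2 + Q ^+ 2 = 1 /\
    rho * s * m + r * Q = tau * y.
  apply: circle_meets_line => //.
  rewrite (exprMn 2 rho s) (exprMn 2 tau y) (exprMn 2 tau p) ss (exprMn 2 sg c).
  apply: le_trans (_ : rho ^+ 2 * ((r ^+ 2 + 1 - c ^+ 2) * (1 - p ^+ 2)) <= _).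
    by rewrite ler_pM ?sqr_ge0.
  rewrite mulrA; apply: ler_pM.
  - by rewrite mulr_ge0 ?sqr_ge0 // -addrA addr_ge0 ?sqr_ge0 // subr_ge0.
  - by rewrite subr_ge0.
  - have -> : rho ^+ 2 * (1 - sg ^+ 2 * c ^+ 2)
        = rho ^+ 2 * (1 - c ^+ 2) + rho ^+ 2 * ((1 - sg ^+ 2) * c ^+ 2) by ring.
    have : 0 <= rho ^+ 2 * ((1 - sg ^+ 2) * c ^+ 2).
      by apply: mulr_ge0; rewrite ?sqr_ge0 // mulr_ge0 ?sqr_ge0 ?subr_ge0.
    have : rho ^+ 2 * r ^+ 2 <= r ^+ 2 by rewrite ler_piMl ?sqr_ge0 // expr_le1.
    lra.
  - by rewrite lerD2l lerN2 ler_piMl ?sqr_ge0.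
have -> : (tau * (c + r * p), tau * y)
    = (rho * (sg * c) + r * (tau * p), rho * s * m + r * Q).
  by rewrite QE -sgE; congr pair; ring.
by apply: geom_value => //; rewrite ss addrC subrK.
Qed.

End Shift.

(** * The support function of the union of the ellipses *)

Section Support.
Variable R : realType.
Implicit Types (r t c : R).

(* Writing x = c + r p instead of dividing by r keeps the case r = 0. *)
Definition ellipses r (q : R * R) := exists c p,
  [/\ c ^+ 2 <= 1, p ^+ 2 <= 1,
      q.2 ^+ 2 <= (r ^+ 2 + 1 - c ^+ 2) * (1 - p ^+ 2) & q.1 = c + r * p].

Lemma ler_of_sqr (x y : R) : 0 <= y -> x ^+ 2 <= y ^+ 2 -> x <= y.
Proof.
move=> y0; rewrite -ler_sqrt ?sqr_ge0 // !sqrtr_sqr (ger0_norm y0).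
exact: le_trans (ler_norm x).
Qed.

(** On a cap, [a = |cos t|] satisfies [(1 - a) (1 + a) <= r a], which gives [1 - a <= r]. The bound
    later permits division by the support function. *)
Lemma foguel_support_ge1 r t : 0 <= r -> 1 <= foguel_support r t.
Proof.
move=> r0; rewrite /foguel_support; have c2 := cos2sin2 t.
case: ifPn => [cap|_].
  have [|C0] := lerP 1 `|cos t|; first lra.
  have n0 := normr_ge0 (cos t).
  have n2 : `|cos t| ^+ 2 = cos t ^+ 2 by rewrite real_normK ?num_real.
  nra.
rewrite -[leLHS]sqrtr1 ler_wsqrtr // lerDl divr_ge0 ?sqr_ge0 //.
Qed.

(** The right side minus the left side is [a^2 (1 - d)^2 + (1 - d) (2 r a - (1 + d) s)]. *)
Lemma cap_ineq (a d r s : R) : 0 <= d <= 1 -> 0 <= s -> s <= r * a ->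
  r ^+ 2 + (1 - d ^+ 2) * s <= (a + r - d * a) ^+ 2.
Proof.
move=> /andP[d0 d1] s0 sa.
have : 0 <= (1 - d) * (2 * r * a - (1 + d) * s).
  by rewrite mulr_ge0 ?subr_ge0 //; nra.
have := sqr_ge0 (a * (1 - d)); lra.
Qed.

(** The left side is the support function of the ellipse with center [(c, 0)]. Off the caps,
    squaring turns the claim into [0 <= (c - h cos t)^2], since [h^2 sin^2 t = sin^2 t + r^2]. *)
Lemma ellipse_support_le r c t : 0 <= r -> c ^+ 2 <= 1 ->
  c * cos t + Num.sqrt (r ^+ 2 + (1 - c ^+ 2) * sin t ^+ 2) <= foguel_support r t.
Proof.
move=> r0 c1; have C2 := cos2sin2 t.
have s0 : 0 <= sin t ^+ 2 by exact: sqr_ge0.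
have D0 : 0 <= r ^+ 2 + (1 - c ^+ 2) * sin t ^+ 2.
  by rewrite addr_ge0 ?sqr_ge0 // mulr_ge0 // subr_ge0.
have c1' : `|c| <= 1 by rewrite -(expr_le1 (n := 2)) // real_normK ?num_real.
have := foguel_support_ge1 t r0; rewrite /foguel_support.
case: ifPn => [cap|top] h1.
  rewrite -lerBrDl; apply: ler_of_sqr; last rewrite sqr_sqrtr //.
    rewrite subr_ge0; apply: le_trans (ler_norm _) _; rewrite normrM.
    have : `|c| * `|cos t| <= `|cos t| by rewrite ler_piMl.
    lra.
  have n2 : `|cos t| ^+ 2 = cos t ^+ 2 by rewrite real_normK ?num_real.
  have n0 := normr_ge0 (cos t).
  have hcC : - (`|c| * `|cos t|) <= c * cos t <= `|c| * `|cos t|.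
    by rewrite -ler_norml normrM.
  move: hcC => /andP[_ hcC].
  have cn2 : `|c| ^+ 2 = c ^+ 2 by rewrite real_normK ?num_real.
  have ca : `|c| * `|cos t| <= `|cos t| by rewrite ler_piMl.
  apply: (@le_trans _ _ ((`|cos t| + r - `|c| * `|cos t|) ^+ 2)).
    by rewrite -cn2 cap_ineq ?c1' ?andbT.
  by rewrite lerXn2r ?nnegrE; lra.
have sn0 : sin t ^+ 2 != 0.
  by apply: contraNneq top => ->; rewrite mulr_ge0.
rewrite -lerBrDl; set h := Num.sqrt _ in h1 *.
have h2 : h ^+ 2 = 1 + r ^+ 2 / sin t ^+ 2.
  by rewrite sqr_sqrtr // addr_ge0 // divr_ge0 ?sqr_ge0.
have h2' : h ^+ 2 * sin t ^+ 2 = sin t ^+ 2 + r ^+ 2.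
  by rewrite h2; field; rewrite -sqrf_eq0.
apply: ler_of_sqr; last rewrite sqr_sqrtr //.
  rewrite subr_ge0; apply: le_trans h1; apply: le_trans (ler_norm _) _; rewrite normrM.
  by rewrite mulr_ile1 // cos_max.
have : 0 <= (c - h * cos t) ^+ 2 by exact: sqr_ge0.
rewrite !sqrrB !exprMn C2; lra.
Qed.

(** Cauchy-Schwarz for [(|p|, w)] and [(r |cos t|, sb |sin t|)], where [w^2 = 1 - p^2] and [sb] is
    the vertical semi-axis. *)
Lemma ellipses_le_support r q t : 0 <= r -> ellipses r q ->
  q.1 * cos t + q.2 * sin t <= foguel_support r t.
Proof.
case: q => x y r0 [c [p /= [c1 p1 hy ->]]].
apply: le_trans (ellipse_support_le t r0 c1).
rewrite mulrDl -addrA lerD2l; apply: le_trans (ler_norm _) _.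
rewrite -sqrtr_sqr ler_wsqrtr //.
set C := cos t; set S := sin t; have cs : C ^+ 2 = 1 - S ^+ 2 := cos2sin2 t.
set b := r ^+ 2 + 1 - c ^+ 2 in hy.
have b0 : 0 <= b by rewrite /b; have := sqr_ge0 r; lra.
have -> : r ^+ 2 + (1 - c ^+ 2) * S ^+ 2 = r ^+ 2 * C ^+ 2 + b * S ^+ 2.
  by rewrite cs /b; ring.
pose w := Num.sqrt (1 - p ^+ 2); pose sb := Num.sqrt b.
have w2 : w ^+ 2 = 1 - p ^+ 2 by rewrite sqr_sqrtr // subr_ge0.
have sb2 : sb ^+ 2 = b by rewrite sqr_sqrtr.
have hy' : `|y| <= sb * w.
  by rewrite -sqrtr_sqr -sqrtrM // ler_wsqrtr.
rewrite -sb2 -[leLHS]real_normK ?num_real //.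
apply: (@le_trans _ _ ((r * `|p| * `|C| + sb * w * `|S|) ^+ 2)).
  rewrite lerXn2r ?nnegrE // ?addr_ge0 ?mulr_ge0 ?sqrtr_ge0 //.
  apply: le_trans (ler_normD _ _) _; rewrite !normrM (ger0_norm r0).
  by rewrite lerD2l ler_wpM2r.
have p2 : `|p| ^+ 2 = 1 - w ^+ 2 by rewrite real_normK ?num_real // w2; ring.
have -> : r ^+ 2 * C ^+ 2 + sb ^+ 2 * S ^+ 2
    = ((r * `|C|) ^+ 2 + (sb * `|S|) ^+ 2) * (`|p| ^+ 2 + w ^+ 2).
  by rewrite p2 subrK mulr1 !exprMn !real_normK ?num_real.
have := sqr_ge0 (r * `|C| * w - sb * `|S| * `|p|); lra.
Qed.

End Support.

(** * The parametrization of the boundary by the normal angle *)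

Section Param.
Variable R : realType.
Implicit Types (r t : R).

(** The positive root [k] of [k^2 + r k = 1], that is, the value of [|cos t|] at which
    [sin^2 t = r |cos t|]. *)
Definition switch_cos r : R := (Num.sqrt (4 + r ^+ 2) - r) / 2.

Lemma switch_cosP r : 0 <= r ->
  [/\ 0 < switch_cos r, switch_cos r <= 1 &
      switch_cos r ^+ 2 + r * switch_cos r = 1].
Proof.
move=> r0; rewrite /switch_cos; set q := Num.sqrt _.
have q2 : q ^+ 2 = 4 + r ^+ 2 by rewrite sqr_sqrtr // addr_ge0 ?sqr_ge0.
have qr : r < q.
  by rewrite -[ltLHS](ger0_norm r0) -sqrtr_sqr ltr_sqrt ?ltr_pwDl ?sqr_ge0.
split; first by rewrite divr_gt0 // subr_gt0.
  have q_le : q <= r + 2 by apply: ler_of_sqr; [lra|rewrite q2; lra].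
  lra.
lra.
Qed.

(** For [a >= 0] the function [a^2 + r a] is increasing, and it equals 1 at [switch_cos r]. *)
Lemma switch_cos_cap r t : 0 <= r ->
  (switch_cos r <= `|cos t|) = (sin t ^+ 2 <= r * `|cos t|).
Proof.
move=> r0; have [k0 k1 kE] := switch_cosP r0.
have -> : sin t ^+ 2 = 1 - `|cos t| ^+ 2.
  by rewrite real_normK ?num_real // cos2sin2; ring.
move: (`|cos t|) (normr_ge0 (cos t)) => a a0.
move: (switch_cos r) k0 k1 kE => k k0 k1 kE; apply/idP/idP; nra.
Qed.

Lemma switch_cos_top r t : 0 <= r ->
  (`|cos t| <= switch_cos r) = (r * `|cos t| <= sin t ^+ 2).
Proof.
move=> r0; have [k0 k1 kE] := switch_cosP r0.
have -> : sin t ^+ 2 = 1 - `|cos t| ^+ 2.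
  by rewrite real_normK ?num_real // cos2sin2; ring.
move: (`|cos t|) (normr_ge0 (cos t)) => a a0.
move: (switch_cos r) k0 k1 kE => k k0 k1 kE; apply/idP/idP; nra.
Qed.

(* The maximizer of c cos t + sqrt(r^2 + (1 - c^2) sin^2 t): it is
   cos t sqrt(1 + r^2 / sin^2 t) as long as this lies in [-1, 1]. Clamping cos t
   first gives the values 1 and -1 beyond this range and keeps the denominator
   away from 0. *)
Definition contact_center r t : R :=
  let K := Num.max (- switch_cos r) (Num.min (switch_cos r) (cos t)) in
  K * Num.sqrt (1 + r ^+ 2 / (1 - K ^+ 2)).
(** The support function, taken about its center, of the ellipse centered at
    [(contact_center r t, 0)]. The two coordinates that follow are those of the point where this
    ellipse is supported in direction [t]. *)
Definition contact_norm r t : R :=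
  Num.sqrt (r ^+ 2 + (1 - contact_center r t ^+ 2) * sin t ^+ 2).
Definition boundary_x r t : R :=
  contact_center r t + r ^+ 2 * cos t / contact_norm r t.
Definition boundary_y r t : R :=
  (r ^+ 2 + 1 - contact_center r t ^+ 2) * sin t / contact_norm r t.

Section Positive.
Variable r : R.
Hypothesis r0 : 0 < r.

Lemma switch_cos_lt1 : switch_cos r < 1.
Proof.
have [k0 k1 kE] := switch_cosP (ltW r0).
rewrite lt_neqAle k1 andbT; apply/eqP => k1'.
by move: kE; rewrite k1' expr1n mulr1 => kE'; have := r0; lra.
Qed.

Lemma norm_clamp_le t :
  let K := Num.max (- switch_cos r) (Num.min (switch_cos r) (cos t)) in
  `|K| <= switch_cos r.
Proof.
have [k0 k1 kE] := switch_cosP (ltW r0).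
rewrite /= ler_norml le_max lexx /= ge_max ge_min lexx /= andbT; lra.
Qed.

(** Multiplied by [1 - K^2], the claim reads [r |K| <= 1 - K^2] after taking roots, and this holds
    because [|K| <= switch_cos r]. *)
Lemma contact_center_sqr_le1 t : contact_center r t ^+ 2 <= 1.
Proof.
rewrite /contact_center; set K := Num.max _ _.
have := norm_clamp_le t; rewrite -/K => /= hK.
have [k0 k1 kE] := switch_cosP (ltW r0); have k1' := switch_cos_lt1.
have K2 : `|K| ^+ 2 = K ^+ 2 by rewrite real_normK ?num_real.
have Kn := normr_ge0 K.
have K21 : 0 < 1 - K ^+ 2.
  by rewrite -K2 subr_gt0 expr_lt1 // (le_lt_trans hK).
have rK : r * `|K| <= 1 - K ^+ 2.
  have : r * `|K| <= r * switch_cos r by rewrite ler_pM2l.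
  have : `|K| ^+ 2 <= switch_cos r ^+ 2 by rewrite lerXn2r // nnegrE ltW.
  lra.
rewrite exprMn sqr_sqrtr; last by rewrite addr_ge0 // divr_ge0 ?sqr_ge0 // ltW.
rewrite -(ler_pM2r K21) mul1r.
have -> : K ^+ 2 * (1 + r ^+ 2 / (1 - K ^+ 2)) * (1 - K ^+ 2)
    = K ^+ 2 * (1 - K ^+ 2) + (r * `|K|) ^+ 2.
  rewrite exprMn K2; field; lra.
have : (r * `|K|) ^+ 2 <= (1 - K ^+ 2) ^+ 2.
  by rewrite lerXn2r ?nnegrE ?mulr_ge0 // ltW.
lra.
Qed.

Lemma contact_normP t : r <= contact_norm r t /\
  contact_norm r t ^+ 2 = r ^+ 2 + (1 - contact_center r t ^+ 2) * sin t ^+ 2.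
Proof.
have c1 := contact_center_sqr_le1 t.
have q0 : 0 <= (1 - contact_center r t ^+ 2) * sin t ^+ 2.
  by rewrite mulr_ge0 ?sqr_ge0 // subr_ge0.
have q1 : 0 <= r ^+ 2 + (1 - contact_center r t ^+ 2) * sin t ^+ 2.
  by rewrite addr_ge0 ?sqr_ge0.
split; last by rewrite sqr_sqrtr.
by rewrite -[leLHS](ger0_norm (ltW r0)) -sqrtr_sqr ler_wsqrtr // lerDl.
Qed.

Lemma contact_norm_gt0 t : 0 < contact_norm r t.
Proof. by have [h _] := contact_normP t; apply: lt_le_trans h. Qed.

Lemma boundary_ellipses t : ellipses r (boundary_x r t, boundary_y r t).
Proof.
exists (contact_center r t), (r * cos t / contact_norm r t).
have D0 := contact_norm_gt0 t; have [_ D2] := contact_normP t.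
have c1 := contact_center_sqr_le1 t.
have C2 := cos2sin2 t.
have E : 1 - (r * cos t / contact_norm r t) ^+ 2 =
   (r ^+ 2 + 1 - contact_center r t ^+ 2) * sin t ^+ 2 / contact_norm r t ^+ 2.
  have -> : (r ^+ 2 + 1 - contact_center r t ^+ 2) * sin t ^+ 2
      = contact_norm r t ^+ 2 - r ^+ 2 * cos t ^+ 2.
    by rewrite D2 C2; ring.
  by field; rewrite gt_eqF.
split => //=.
- rewrite -subr_ge0 E divr_ge0 ?sqr_ge0 // mulr_ge0 ?sqr_ge0 //.
  by rewrite -addrA addr_ge0 ?sqr_ge0 // subr_ge0.
- by rewrite E /boundary_y le_eqVlt; apply/orP; left; apply/eqP; field; rewrite gt_eqF.
- by rewrite /boundary_x !mulrA -expr2.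
Qed.

Lemma boundary_dot t :
  boundary_x r t * cos t + boundary_y r t * sin t
  = contact_center r t * cos t + contact_norm r t.
Proof.
have D0 := contact_norm_gt0 t; have [_ D2] := contact_normP t.
rewrite /boundary_x /boundary_y.
transitivity (contact_center r t * cos t + (r ^+ 2 * cos t ^+ 2
  + (r ^+ 2 + 1 - contact_center r t ^+ 2) * sin t ^+ 2) / contact_norm r t).
  by field; rewrite gt_eqF.
have -> : r ^+ 2 * cos t ^+ 2 + (r ^+ 2 + 1 - contact_center r t ^+ 2) * sin t ^+ 2
    = contact_norm r t ^+ 2.
  by rewrite D2 cos2sin2; ring.
by field; rewrite gt_eqF.
Qed.

Lemma contact_cap t : sin t ^+ 2 <= r * `|cos t| ->
  contact_center r t = Num.sg (cos t) /\ contact_norm r t = r.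
Proof.
rewrite -(switch_cos_cap _ (ltW r0)) => hk.
have [k0 k1 kE] := switch_cosP (ltW r0); have k1' := switch_cos_lt1.
(* At [k = switch_cos r] one has [1 - k^2 = r k], so the root is [1 / k]: the clamped center is
   exactly 1 or -1. *)
have lamk : switch_cos r * Num.sqrt (1 + r ^+ 2 / (1 - switch_cos r ^+ 2)) = 1.
  have kr : 1 - switch_cos r ^+ 2 = r * switch_cos r by lra.
  have -> : 1 + r ^+ 2 / (1 - switch_cos r ^+ 2) = (switch_cos r)^-1 ^+ 2.
    rewrite kr.
    transitivity ((switch_cos r ^+ 2 + r * switch_cos r) / switch_cos r ^+ 2).
      by field; rewrite !gt_eqF.
    by rewrite kE mul1r exprVn.
  by rewrite sqrtr_sqr gtr0_norm ?invr_gt0 // divff // gt_eqF.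
have cE : contact_center r t = Num.sg (cos t).
  rewrite /contact_center; case: (ltrgt0P (cos t)) hk => C0 hk; last by lra.
    rewrite (min_idPl hk) (_ : Num.max _ _ = switch_cos r) ?lamk ?gtr0_sg //.
    by apply/max_idPr; lra.
  rewrite (min_idPr _); last by lra.
  rewrite (max_idPl _); last by lra.
  by rewrite sqrrN mulNr lamk ltr0_sg.
split=> //; rewrite /contact_norm cE sqr_sg.
have -> : cos t != 0.
  by apply: contraTneq hk => ->; rewrite normr0 -ltNge.
by rewrite subrr mul0r addr0 sqrtr_sqr gtr0_norm.
Qed.

(** The clamp is inactive here. The radicand of [contact_norm] becomes a perfect square after
    [cos^2 t = 1 - sin^2 t]. *)
Lemma contact_top t : r * `|cos t| <= sin t ^+ 2 ->
  let lam := Num.sqrt (1 + r ^+ 2 / sin t ^+ 2) in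
  [/\ sin t != 0, 0 < lam, lam ^+ 2 = 1 + r ^+ 2 / sin t ^+ 2,
      contact_center r t = cos t * lam & contact_norm r t = sin t ^+ 2 * lam].
Proof.
move=> top lam.
have [k0 k1 kE] := switch_cosP (ltW r0); have k1' := switch_cos_lt1.
have s0 : sin t != 0.
  apply: contraTneq top => s0; rewrite s0 expr0n /= -ltNge mulr_gt0 // normr_gt0.
  by apply: contra_eq_neq (cos2Dsin2 t) => ->; rewrite s0 expr0n addr0 eq_sym oner_eq0.
have lam2 : lam ^+ 2 = 1 + r ^+ 2 / sin t ^+ 2.
  by rewrite sqr_sqrtr // addr_ge0 // divr_ge0 ?sqr_ge0.
have lam0 : 0 < lam by rewrite sqrtr_gt0 ltr_pwDl // divr_ge0 ?sqr_ge0.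
have cE : contact_center r t = cos t * lam.
  move: top; rewrite -(switch_cos_top _ (ltW r0)) ler_norml => /andP[h1 h2].
  by rewrite /contact_center (min_idPr h2) (max_idPr h1) cos2sin2 subKr.
split=> //; rewrite /contact_norm cE.
have -> : r ^+ 2 + (1 - (cos t * lam) ^+ 2) * sin t ^+ 2 = (sin t ^+ 2 * lam) ^+ 2.
  by rewrite !exprMn lam2 cos2sin2; field.
by rewrite sqrtr_sqr ger0_norm // mulr_ge0 ?sqr_ge0 // ltW.
Qed.

Lemma boundary_support t :
  boundary_x r t * cos t + boundary_y r t * sin t = foguel_support r t.
Proof.
rewrite boundary_dot /foguel_support; case: ifPn => [/contact_cap[-> ->]|].
  by rewrite mulrC normrEsg mulrC.
rewrite -ltNge => /ltW /contact_top[s0 _ _ -> ->]; set lam := Num.sqrt _.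
transitivity (lam * (cos t ^+ 2 + sin t ^+ 2)); first by ring.
by rewrite cos2Dsin2 mulr1.
Qed.

Lemma boundary_cap t : sin t ^+ 2 <= r * `|cos t| ->
  boundary_x r t = Num.sg (cos t) + r * cos t /\ boundary_y r t = r * sin t.
Proof.
move=> cap; have [cE DE] := contact_cap cap.
rewrite /boundary_x /boundary_y cE DE sqr_sg.
have -> : cos t != 0.
  apply: contraTneq cap => c0; rewrite c0 normr0 mulr0 -ltNge.
  by have := cos2Dsin2 t; rewrite c0 expr0n add0r => ->.
rewrite addrK; by split; field; rewrite gt_eqF.
Qed.

Lemma boundary_top t : r * `|cos t| <= sin t ^+ 2 ->
  foguel_poly r (boundary_x r t ^+ 2) (boundary_y r t ^+ 2) = 0.
Proof.
move=> /contact_top[s0 lam0 lam2 cE DE].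
rewrite /boundary_x /boundary_y cE DE.
move: lam0 lam2; set lam := Num.sqrt _ => lam0 lam2.
(* Both squared coordinates are rational functions of [w] and [r], so that membership in the curve
   becomes a rational identity. *)
pose w := sin t ^+ 2.
have w0 : w != 0 by rewrite sqrf_eq0.
have wr : w + r ^+ 2 != 0.
  by rewrite gt_eqF // ltr_wpDl ?sqr_ge0 // exprn_gt0.
have -> : (cos t * lam + r ^+ 2 * cos t / (sin t ^+ 2 * lam)) ^+ 2 =
    (1 - w) * (w + 2 * r ^+ 2) ^+ 2 / (w * (w + r ^+ 2)).
  transitivity (cos t ^+ 2 * (lam ^+ 2 * w + r ^+ 2) ^+ 2 / (w ^+ 2 * lam ^+ 2)).
    by rewrite /w; field; rewrite gt_eqF.
  by rewrite lam2 cos2sin2 -/w; field; rewrite w0 wr.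
have -> : ((r ^+ 2 + 1 - (cos t * lam) ^+ 2) * sin t / (sin t ^+ 2 * lam)) ^+ 2 =
    (w ^+ 2 + 2 * r ^+ 2 * w - r ^+ 2) ^+ 2 / (w ^+ 2 * (w + r ^+ 2)).
  transitivity ((r ^+ 2 + 1 - cos t ^+ 2 * lam ^+ 2) ^+ 2 / (w * lam ^+ 2)).
    by rewrite /w; field; rewrite gt_eqF.
  by rewrite lam2 cos2sin2 -/w; field; rewrite w0 wr.
by rewrite /foguel_poly; field; rewrite w0 wr.
Qed.

(* The ellipse that contributes the point for t is smooth and lies in the half-plane
   supporting at t', so its normal at that point is the one of t' as well: this is
   the equality case of Cauchy-Schwarz. *)
Lemma boundary_inj t t' : boundary_x r t = boundary_x r t' ->
  boundary_y r t = boundary_y r t' -> cos t = cos t' /\ sin t = sin t'.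
Proof.
move=> hx hy.
have D1 := contact_norm_gt0 t; have [_ D1E] := contact_normP t.
pose c := contact_center r t; have c1 : c ^+ 2 <= 1 := contact_center_sqr_le1 t.
have := ellipse_support_le t' (ltW r0) c1.
rewrite -boundary_support -hx -hy /boundary_x /boundary_y -/c.
rewrite -/c in D1E.
have D2E : Num.sqrt (r ^+ 2 + (1 - c ^+ 2) * sin t' ^+ 2) ^+ 2 =
    r ^+ 2 + (1 - c ^+ 2) * sin t' ^+ 2.
  by rewrite sqr_sqrtr // addr_ge0 ?sqr_ge0 // mulr_ge0 ?sqr_ge0 // subr_ge0.
have : 0 < Num.sqrt (r ^+ 2 + (1 - c ^+ 2) * sin t' ^+ 2).
  rewrite sqrtr_gt0 ltr_pwDl ?exprn_gt0 //.
  by rewrite mulr_ge0 ?sqr_ge0 // subr_ge0.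
move: (Num.sqrt _) D2E => D2 D2E D2gt0.
have C2 := cos2Dsin2 t'; have C1 := cos2Dsin2 t.
move: (contact_norm r t) D1 D1E => D1 D1gt0 D1E.
pose b := r ^+ 2 + 1 - c ^+ 2.
have b0 : 0 < b by rewrite /b -addrA ltr_pwDl ?exprn_gt0 // subr_ge0.
move: (cos t) (sin t) (cos t') (sin t') C1 C2 D1E D2E => u v u' v' C1 C2 D1E D2E.
rewrite -/b => le; pose T := r ^+ 2 * u * u' + b * v * v'.
have {}D1E : D1 ^+ 2 = r ^+ 2 * u ^+ 2 + b * v ^+ 2.
  by rewrite D1E (_ : u ^+ 2 = 1 - v ^+ 2) /b; [ring|rewrite -C1 addrK].
have {}D2E : D2 ^+ 2 = r ^+ 2 * u' ^+ 2 + b * v' ^+ 2.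
  by rewrite D2E (_ : u' ^+ 2 = 1 - v' ^+ 2) /b; [ring|rewrite -C2 addrK].
have leT : D1 * D2 <= T.
  rewrite mulrC -ler_pdivlMr //; move: le.
  rewrite (_ : _ + _ * v' = c * u' + T / D1) ?lerD2l //.
  by rewrite /T; field; rewrite gt_eqF.
have T0 : 0 < T by apply: lt_le_trans leT; rewrite mulr_gt0.
have uv : u * v' = u' * v.
  apply/eqP; rewrite -subr_eq0 -sqrf_eq0 eq_le sqr_ge0 andbT.
  rewrite -(pmulr_rle0 _ (mulr_gt0 (exprn_gt0 2 r0) b0)).
  have -> : r ^+ 2 * b * (u * v' - u' * v) ^+ 2 = (D1 * D2) ^+ 2 - T ^+ 2.
    by rewrite exprMn D1E D2E /T; ring.
  by rewrite subr_le0 lerXn2r ?nnegrE // ltW // mulr_gt0.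
(* This is [cos (t - t')]. By [uv] the two unit normals are parallel, so [k] is 1 or -1, and the
   positivity of [T] excludes -1. *)
pose k := u * u' + v * v'.
have uk : u = u' * k.
  transitivity (u * (u' ^+ 2 + v' ^+ 2)); first by rewrite C2 mulr1.
  transitivity (u * u' ^+ 2 + (u * v') * v'); first by ring.
  by rewrite uv /k; ring.
have vk : v = v' * k.
  transitivity (v * (u' ^+ 2 + v' ^+ 2)); first by rewrite C2 mulr1.
  transitivity (v * v' ^+ 2 + (u' * v) * u'); first by ring.
  by rewrite -uv /k; ring.
have k2 : k ^+ 2 = 1.
  rewrite -C1 [in RHS]uk [in RHS]vk.
  transitivity (k ^+ 2 * (u' ^+ 2 + v' ^+ 2)); first by rewrite C2 mulr1.
  by ring.
have k0 : 0 < k.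
  have : 0 < k * D2 ^+ 2.
    rewrite (_ : _ * _ = T) // D2E /T [in RHS]uk [in RHS]vk; ring.
  by rewrite pmulr_lgt0 // exprn_gt0.
have k1 : k = 1.
  move/eqP: k2; rewrite sqrf_eq1 => /orP[/eqP //|/eqP kN].
  by move: k0; rewrite kN ltr0N1.
by rewrite uk vk k1 !mulr1.
Qed.

End Positive.

End Param.

Section Cont.
Variable R : realType.
Variable r : R.
Hypothesis r0 : 0 < r.

Lemma continuous_contact_center : continuous (contact_center r).
Proof.
move=> t; rewrite /contact_center.
pose K (u : R) := Num.max (- switch_cos r) (Num.min (switch_cos r) (cos u)).
have Kc : {for t, continuous K}.
  apply: (@continuous_max _ _ (fun=> _)); first exact: cvg_cst.
  apply: (@continuous_min _ _ (fun=> _)); first exact: cvg_cst.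
  exact: continuous_cos.
(* The clamp keeps [|K|] at most [switch_cos r < 1], so the denominator does not vanish even where
   [sin t = 0]. *)
have K1 : 1 - K t * K t != 0.
  have := norm_clamp_le r0 t; rewrite /= -/(K t) => h.
  have : `|K t| < 1 by apply: le_lt_trans h (switch_cos_lt1 r0).
  by rewrite -expr2 -real_normK ?num_real // => h1; rewrite gt_eqF // subr_gt0 expr_lt1.
rewrite (_ : (fun t => _) = fun u => K u * Num.sqrt (1 + r ^+ 2 * (1 - K u * K u)^-1)) //.
apply: cvgM => //; apply: continuous_comp; last exact: sqrt_continuous.
apply: cvgD; first exact: cvg_cst.
apply: cvgM; first exact: cvg_cst.
apply: cvgV => //; apply: cvgB; first exact: cvg_cst.
exact: cvgM.
Qed.

Lemma continuous_contact_norm : continuous (contact_norm r).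
Proof.
move=> t; rewrite (_ : contact_norm r = fun u => Num.sqrt (r ^+ 2 +
  (1 - contact_center r u * contact_center r u) * (sin u * sin u))) //.
have hc := @continuous_contact_center t; have hs := @continuous_sin R t.
apply: continuous_comp; last exact: sqrt_continuous.
apply: cvgD; first exact: cvg_cst.
apply: cvgM; last exact: cvgM.
by apply: cvgB; [exact: cvg_cst|exact: cvgM].
Qed.

Lemma continuous_boundary_x : continuous (boundary_x r).
Proof.
move=> t; have hc := @continuous_contact_center t.
apply: cvgD => //; apply: cvgM.
  by apply: cvgM; [exact: cvg_cst|exact: continuous_cos].
by apply: cvgV; [rewrite gt_eqF // contact_norm_gt0|exact: continuous_contact_norm].
Qed.

Lemma continuous_boundary_y : continuous (boundary_y r).
Proof.
move=> t; have hc := @continuous_contact_center t.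
rewrite (_ : boundary_y r = fun u => (r ^+ 2 + 1 -
  contact_center r u * contact_center r u) * sin u / contact_norm r u) //.
apply: cvgM; last first.
  by apply: cvgV; [rewrite gt_eqF // contact_norm_gt0|exact: continuous_contact_norm].
apply: cvgM; last exact: continuous_sin.
by apply: cvgB; [exact: cvg_cst|exact: cvgM].
Qed.

End Cont.

(** * Angles modulo a full turn, and the boundary map for all [r >= 0] *)

Section Trig.
Variable R : realType.
Implicit Types t : R.

(** The hypotheses give [cos (t - t') = 1], hence a zero of the sine at half the difference, which
    lies strictly between [- pi] and [pi]. *)
Lemma cos_sin_inj t t' :
  `|t - t'| < pi *+ 2 -> cos t = cos t' -> sin t = sin t' -> t = t'.
Proof.
move=> tt ct st.
have h2 : sin ((t - t') / 2) = 0.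
  have : cos (t - t') = 1 by rewrite cosB ct st -!expr2 cos2Dsin2.
  rewrite [in X in X -> _](splitr (t - t')) cosD -!expr2 cos2sin2.
  by move=> h; apply/eqP; rewrite -sqrf_eq0; apply/eqP; lra.
have {}tt : `|(t - t') / 2| < pi.
  by rewrite normrM [X in _ * X]gtr0_norm ?invr_gt0 // ltr_pdivrMr // mulr_natr.
suff : (t - t') / 2 = 0 by lra.
move: ((t - t') / 2) h2 tt => x sx; rewrite ltr_norml => /andP[x1 x2].
case: (ltrgt0P x) => [x0|x0|-> //].
  by have := @sin_gt0_pi _ x; rewrite x0 x2 sx ltxx => /(_ isT).
have := @sin_gt0_pi _ (- x).
by rewrite oppr_gt0 x0 sinN sx oppr0 ltxx ltrNl x1 => /(_ isT).
Qed.

Lemma angle_reduction t :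
  exists t', [/\ 0 <= t', t' < pi *+ 2, cos t' = cos t & sin t' = sin t].
Proof.
have cB : -1 <= cos t <= 1 by rewrite cos_geN1 cos_le1.
have [/andP[a0 a1] aK] := acos_def cB.
have s2 : sin (acos (cos t)) = `|sin t|.
  have h : sin (acos (cos t)) ^+ 2 = sin t ^+ 2 by rewrite !sin2cos2 aK.
  have s0 : 0 <= sin (acos (cos t)) by apply: sin_ge0_pi; rewrite a0.
  by rewrite -[LHS]ger0_norm // -!sqrtr_sqr h.
have [st|st] := leP 0 (sin t).
  exists (acos (cos t)); split => //; last by rewrite s2 ger0_norm.
  by apply: le_lt_trans a1 _; rewrite mulr2n ltrDl pi_gt0.
exists (- acos (cos t) + pi *+ 2); split.
- by rewrite mulr2n; have := pi_gt0 R; lra.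
(* The bound is strict because [sin t < 0] excludes [acos (cos t) = 0]. *)
- rewrite gtrDr oppr_lt0 lt_neqAle a0 andbT; apply/eqP => a00.
  move: s2; rewrite -a00 sin0 => /esym/eqP; rewrite normr_eq0 => /eqP s00.
  by rewrite s00 ltxx in st.
- by rewrite cosD2pi cosN.
- by rewrite sinD2pi sinN s2 ltr0_norm // opprK.
Qed.

End Trig.

Section Map.
Variable R : realType.
Implicit Types (r t : R) (px py : R -> R).

(** A common interface for [r > 0] and [r = 0]; in the latter case [contact_norm] vanishes where
    [sin t = 0]. *)
Record boundary_map r px py : Prop := BoundaryMap {
  bm_contx : continuous px;
  bm_conty : continuous py;
  bm_ext : forall t t', cos t = cos t' -> sin t = sin t' ->
    px t = px t' /\ py t = py t';
  bm_inj : forall t t', px t = px t' -> py t = py t' ->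
    cos t = cos t' /\ sin t = sin t';
  bm_ellipses : forall t, ellipses r (px t, py t);
  bm_supp : forall t, px t * cos t + py t * sin t = foguel_support r t;
  bm_cap : forall t, sin t ^+ 2 <= r * `|cos t| ->
    px t = Num.sg (cos t) + r * cos t /\ py t = r * sin t;
  bm_top : forall t, r * `|cos t| <= sin t ^+ 2 ->
    foguel_poly r (px t ^+ 2) (py t ^+ 2) = 0 }.

Lemma boundary_map_exists r : 0 <= r -> exists px py, boundary_map r px py.
Proof.
rewrite le_eqVlt => /predU1P[<-|r0]; last first.
  exists (boundary_x r), (boundary_y r); split.
  - exact: continuous_boundary_x.
  - exact: continuous_boundary_y.
  - by move=> t t' ct st; rewrite /boundary_x /boundary_y /contact_norm /contact_center ct st.
  - exact: boundary_inj.
  - exact: boundary_ellipses.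
  - exact: boundary_support.
  - exact: boundary_cap.
  - exact: boundary_top.
(* For [r = 0] the ellipses degenerate to the vertical chords of the unit disk, and the caps to the
   points [(1, 0)] and [(-1, 0)]. *)
exists cos, sin; split => //.
- exact: continuous_cos.
- exact: continuous_sin.
- move=> t; exists (cos t), 0; rewrite /= expr0n /= mul0r addr0 add0r subr0 mulr1.
  by rewrite cos2sin2 subKr lexx ler01 gerBl sqr_ge0.
- move=> t; rewrite -!expr2 cos2Dsin2 /foguel_support mul0r expr0n /= mul0r !addr0 sqrtr1.
  case: ifP => // s0; have {}s0 : sin t = 0.
    by apply/eqP; rewrite -sqrf_eq0 eq_le s0 sqr_ge0.
  by apply/esym/eqP; rewrite norm_cos_eq1 s0.
- move=> t; rewrite !mul0r addr0 => s0; have {}s0 : sin t = 0.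
    by apply/eqP; rewrite -sqrf_eq0 eq_le s0 sqr_ge0.
  split=> //; rewrite [LHS]numEsg; have /eqP : `|cos t| == 1 by rewrite norm_cos_eq1 s0.
  by move=> ->; rewrite mulr1.
- by move=> t _; rewrite /foguel_poly cos2sin2; ring.
Qed.

End Map.

(** * Planar sets given by their support points *)

Section Planar.
Variable R : realType.
Variables px py : R -> R.
Hypothesis px_cont : continuous px.
Hypothesis py_cont : continuous py.
Hypothesis p_ext : forall t t',
  cos t = cos t' -> sin t = sin t' -> px t = px t' /\ py t = py t'.

Let h t := px t * cos t + py t * sin t.
Hypothesis h_max : forall t t', px t' * cos t + py t' * sin t <= h t.
Hypothesis h_ge1 : forall t, 1 <= h t.

(* With P = (px, py) and n = (cos, sin), the two maximality conditions give
   (P(t + e) - p).(n(t + e) - n(t)) >= 0, and n(t + e) - n(t) is 2 sin(e / 2) times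
   a unit vector that tends to n'(t). Letting e -> 0 from both sides shows that
   P(t) - p is orthogonal to n'(t); it is orthogonal to n(t) by assumption. *)
Lemma support_point_unique (p : R * R) t :
  (forall t', p.1 * cos t' + p.2 * sin t' <= h t') ->
  p.1 * cos t + p.2 * sin t = h t -> p = (px t, py t).
Proof.
move=> ple pt.
pose D e := (px (t + e) - p.1) * - sin (t + e / 2)
  + (py (t + e) - p.2) * cos (t + e / 2).
have key e : 0 <= sin (e / 2) * D e.
  have h1 := ple (t + e); have h2 := h_max t (t + e).
  have : 0 <= (px (t + e) - p.1) * (cos (t + e) - cos t)
      + (py (t + e) - p.2) * (sin (t + e) - sin t).
    by rewrite -pt in h2; move: h1; rewrite /h; lra.
  have te : t + e = (t + e / 2) + e / 2 by lra.
  have t0 : t = (t + e / 2) - e / 2 by lra.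
  have -> : cos (t + e) - cos t = 2 * sin (e / 2) * - sin (t + e / 2).
    by rewrite {1}te {2}t0 cosD cosB; ring.
  have -> : sin (t + e) - sin t = 2 * sin (e / 2) * cos (t + e / 2).
    by rewrite {1}te {2}t0 sinD sinB; ring.
  move=> hh; rewrite -(pmulr_rge0 _ (ltr0n R 2)); apply: le_trans hh _.
  by rewrite /D le_eqVlt; apply/orP; left; apply/eqP; ring.
have Dc : {for 0, continuous D}.
  have ct : {for 0, continuous (fun e : R => t + e)}.
    by apply: cvgD; [exact: cvg_cst|exact: cvg_id].
  have ct2 : {for 0, continuous (fun e : R => t + e / 2)}.
    by apply: cvgD; [exact: cvg_cst|apply: cvgM; [exact: cvg_id|exact: cvg_cst]].
  apply: cvgD; apply: cvgM.
  - apply: cvgB; last exact: cvg_cst.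
    by apply: continuous_comp => //; apply: px_cont.
  - by apply: cvgN; apply: continuous_comp => //; exact: continuous_sin.
  - apply: cvgB; last exact: cvg_cst.
    by apply: continuous_comp => //; apply: py_cont.
  - by apply: continuous_comp => //; exact: continuous_cos.
have D0 : D 0 = 0.
  apply/eqP; apply: contraT => D0.
  have : \forall e \near (0 : R), 0 < D 0 * D e.
    have DD : D 0 * D e @[e --> (0 : R)] --> D 0 * D 0.
      by apply: cvgM; [exact: cvg_cst|exact: Dc].
    by apply: (cvgr_gt _ DD); rewrite -expr2 exprn_even_gt0.
  move=> /nbhs_ballP[d /= d0 hd].
  pose e := Num.min (d / 2) 1.
  have e0 : 0 < e by rewrite lt_min divr_gt0 //=.
  have ed : e < d by rewrite gt_min; apply/orP; left; lra.
  have e1 : e <= 1 by rewrite ge_min lexx orbT.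
  have s0 : 0 < sin (e / 2).
    by apply: sin_gt0_pi; have := pi_ge2 R; lra.
  have De : 0 <= D e by rewrite -(pmulr_rge0 _ s0).
  have Dne : D (- e) <= 0.
    by have := key (- e); rewrite mulNr sinN mulNr oppr_ge0 pmulr_rle0.
  have be : 0 < D 0 * D e.
    by apply: hd; rewrite /ball /= sub0r normrN gtr0_norm.
  have bne : 0 < D 0 * D (- e).
    by apply: hd; rewrite /ball /= sub0r opprK gtr0_norm.
  have := mulr_gt0 be bne; rewrite mulrACA -expr2 pmulr_rgt0 ?exprn_even_gt0 //.
  by rewrite ltNge mulr_ge0_le0.
move: D0; rewrite /D mul0r !addr0 => D0.
rewrite [p]surjective_pairing; congr pair; apply/eqP; rewrite eq_sym -subr_eq0; apply/eqP.
  transitivity ((px t - p.1) * (cos t ^+ 2 + sin t ^+ 2)).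
    by rewrite cos2Dsin2 mulr1.
  transitivity (cos t * (h t - (p.1 * cos t + p.2 * sin t))
    - sin t * ((px t - p.1) * - sin t + (py t - p.2) * cos t)); first by rewrite /h; ring.
  by rewrite D0 pt subrr !mulr0 subrr.
transitivity ((py t - p.2) * (cos t ^+ 2 + sin t ^+ 2)).
  by rewrite cos2Dsin2 mulr1.
transitivity (sin t * (h t - (p.1 * cos t + p.2 * sin t))
    + cos t * ((px t - p.1) * - sin t + (py t - p.2) * cos t)); first by rewrite /h; ring.
by rewrite D0 pt subrr !mulr0 addr0.
Qed.

(* t maximizes the ratio of p.n and h, and M is the maximum. *)
Lemma polar_form (p : R * R) : exists M t,
  0 <= M /\ p = (M * px t, M * py t).
Proof.
have h_gt0 t : 0 < h t by apply: lt_le_trans (h_ge1 t).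
pose f t := (p.1 * cos t + p.2 * sin t) / h t.
have f_cont : continuous f.
  move=> t; have hc := @continuous_cos R t; have hs := @continuous_sin R t.
  apply: cvgM.
    by apply: cvgD; apply: cvgM => //; exact: cvg_cst.
  apply: cvgV; first by rewrite gt_eqF.
  by apply: cvgD; apply: cvgM => //; [exact: px_cont|exact: py_cont].
have pi2 : 0 <= pi *+ 2 :> R by rewrite mulrn_wge0 // pi_ge0.
have [|t0 _ f_max] := @EVT_max R f 0 (pi *+ 2) pi2.
  exact: continuous_subspaceT.
have {}f_max t : f t <= f t0.
  have [t' [t'0 t'1 ct st]] := angle_reduction t.
  have [ex ey] := p_ext ct st.
  have -> : f t = f t' by rewrite /f /h ex ey ct st.
  by apply: f_max; rewrite in_itv /= t'0 ltW.
have M0 : 0 <= f t0.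
  rewrite leNgt; apply/negP => M0.
  have h1 := le_lt_trans (f_max 0) M0; have h2 := le_lt_trans (f_max (0 + pi)) M0.
  move: h1 h2; rewrite /f !pmulr_llt0 ?invr_gt0 // cosDpi sinDpi; lra.
have f_max' t : p.1 * cos t + p.2 * sin t <= f t0 * h t.
  by rewrite -ler_pdivrMr //; exact: f_max.
exists (f t0), t0; split => //; have [M00|Mn0] := eqVneq (f t0) 0.
  have fle t : p.1 * cos t + p.2 * sin t <= 0 by have := f_max' t; rewrite M00 mul0r.
  rewrite M00 !mul0r [p]surjective_pairing; congr pair.
    by have := fle 0; have := fle pi; rewrite cos0 sin0 cospi sinpi; lra.
  have := fle (pi / 2); have := fle (- (pi / 2)).
  rewrite cosN sinN cos_pihalf sin_pihalf; lra.
have Mgt : 0 < f t0 by rewrite lt_neqAle eq_sym Mn0.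
have : (p.1 / f t0, p.2 / f t0) = (px t0, py t0).
  apply: support_point_unique => [t|] /=.
    rewrite (_ : _ + _ = (p.1 * cos t + p.2 * sin t) / f t0); last by ring.
    by rewrite ler_pdivrMr // [leRHS]mulrC.
  rewrite (_ : _ + _ = (p.1 * cos t0 + p.2 * sin t0) / f t0); last by ring.
  apply: (mulIf Mn0); rewrite divfK // /f [RHS]mulrC divfK ?gt_eqF //.
by move=> [<- <-]; rewrite ![f t0 * _]mulrC !divfK // -surjective_pairing.
Qed.

Variable W : set (R * R).
Hypothesis W_lt : forall p, W p -> forall t, p.1 * cos t + p.2 * sin t < h t.
Hypothesis W_scale : forall t tau, 0 <= tau -> tau < 1 -> W (tau * px t, tau * py t).

(** Writing [p] as [M] times the boundary point for [t], the half-plane condition at this [t] says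
    [M < 1], and scaling applies. *)
Lemma W_halfplanes p : W p <-> forall t, p.1 * cos t + p.2 * sin t < h t.
Proof.
split; first exact: W_lt.
have [M [t [M0 ->]]] := polar_form p => /(_ t) /=.
rewrite (_ : _ + _ = M * h t); last by rewrite /h; ring.
rewrite gtr_pMl ?(lt_le_trans _ (h_ge1 t)) //; exact: W_scale.
Qed.

Lemma dot_normal_le (p q : R * R) e t : `|q.1 - p.1| < e -> `|q.2 - p.2| < e ->
  q.1 * cos t + q.2 * sin t <= p.1 * cos t + p.2 * sin t + 2 * e.
Proof.
move=> h1 h2.
have : `|(q.1 - p.1) * cos t| <= e.
  by rewrite normrM -[leRHS]mulr1 ler_pM // ?cos_max // ltW.
have : `|(q.2 - p.2) * sin t| <= e.
  by rewrite normrM -[leRHS]mulr1 ler_pM // ?sin_max // ltW.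
rewrite !ler_norml; lra.
Qed.

Lemma W_open : open W.
Proof.
rewrite openE => p Wp; apply/nbhs_ballP.
have [M [t0 [M0 pE]]] := polar_form p.
have M1 : M < 1.
  have := W_lt Wp t0; rewrite pE /= (_ : _ + _ = M * h t0); last by rewrite /h; ring.
  by rewrite gtr_pMl ?(lt_le_trans _ (h_ge1 t0)).
(* Moving within this radius changes the linear functional by at most [(1 - M) / 2], less than the
   gap [(1 - M) * h t], as [h t >= 1]. *)
exists ((1 - M) / 4); first by rewrite /= divr_gt0 // subr_gt0.
move=> q [/= b1 b2]; apply/W_halfplanes => t.
have := @dot_normal_le p q _ t _ _.
move=> /(_ ((1 - M) / 4)); rewrite distrC => /(_ b1); rewrite distrC => /(_ b2) hq.
apply: le_lt_trans hq _.
have : p.1 * cos t + p.2 * sin t <= M * h t.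
  rewrite pE /= (_ : _ + _ = M * (px t0 * cos t + py t0 * sin t)); last by ring.
  by rewrite ler_wpM2l.
have : (1 - M) * 1 <= (1 - M) * h t by rewrite ler_wpM2l // subr_ge0 ltW.
lra.
Qed.

Lemma closure_W_le p : closure W p -> forall t, p.1 * cos t + p.2 * sin t <= h t.
Proof.
move=> cp t; apply/ler_addgt0Pr => e e0.
have [q [Wq [/= b1 b2]]] := cp _ (nbhsx_ballx p (e / 2) (divr_gt0 e0 (ltr0n R 2))).
have := @dot_normal_le q p (e / 2) t b1 b2; have := W_lt Wq t; lra.
Qed.

Lemma closure_W_boundary t : closure W (px t, py t).
Proof.
move=> B /nbhs_ballP[e /= e0 hB].
pose m := `|px t| + `|py t| + 1.
have m0 : 0 < m by rewrite /m ltr_wpDl // addr_ge0.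
(* Contraction by [1 - d] moves each coordinate by less than [d * m < e]; the bound 1 keeps the
   factor nonnegative. *)
pose d := Num.min (e / (2 * m)) 1.
have d0 : 0 < d by rewrite lt_min ltr01 andbT divr_gt0 // mulr_gt0.
have d1 : d <= 1 by rewrite ge_min lexx orbT.
have dm : d * m < e.
  rewrite -ltr_pdivlMr // gt_min; apply/orP; left.
  by rewrite ltr_pM2l // ltf_pV2 ?posrE ?mulr_gt0 //; lra.
exists ((1 - d) * px t, (1 - d) * py t); split; first by apply: W_scale; lra.
apply: hB; split; rewrite /ball /=.
  rewrite (_ : _ - _ = d * px t); last by ring.
  rewrite normrM gtr0_norm //; apply: le_lt_trans dm; rewrite ler_pM2l //.
  by rewrite /m -addrA lerDl addr_ge0.
rewrite (_ : _ - _ = d * py t); last by ring.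
rewrite normrM gtr0_norm //; apply: le_lt_trans dm; rewrite ler_pM2l //.
by rewrite /m addrAC lerDr addr_ge0.
Qed.

(** As [W] is open, its boundary is the closure without [W]. For [p] equal to [M] times a boundary
    point, the closure gives [M <= 1], while [M < 1] would put [p] in [W]. *)
Lemma boundary_W p : boundary W p <-> exists t, p = (px t, py t).
Proof.
have -> : boundary W = closure W `\` W.
  by rewrite /boundary (interior_id _).1 //; exact: W_open.
split=> [[cp nWp]|[t ->]].
  have [M [t [M0 pE]]] := polar_form p; exists t.
  suff M1 : M = 1 by rewrite pE M1 !mul1r.
  apply/eqP; rewrite eq_le; apply/andP; split; last first.
    rewrite leNgt; apply/negP => M1; apply: nWp; rewrite pE; exact: W_scale.
  have := closure_W_le cp t; rewrite pE /= (_ : _ + _ = M * h t); last by rewrite /h; ring.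
  by rewrite ger_pMl ?(lt_le_trans _ (h_ge1 t)).
split; first exact: closure_W_boundary.
by move=> /W_lt /(_ t) /=; rewrite ltxx.
Qed.

End Planar.

(** * Switching angles, supporting lines and the closed boundary path *)

Section Angles.
Variable R : realType.
Implicit Types r t th : R.

Lemma foguel_supportN r t : foguel_support r (- t) = foguel_support r t.
Proof. by rewrite /foguel_support cosN sinN sqrrN. Qed.

Lemma foguel_support_piB r t : foguel_support r (pi - t) = foguel_support r t.
Proof.
by rewrite /foguel_support [pi - t]addrC cosDpi sinDpi cosN sinN normrN opprK.
Qed.

Lemma cos_ge_cos th t : th <= pi -> `|t| <= th -> cos th <= cos t.
Proof.
move=> thpi tth; rewrite leNgt -cos_norm ltr_cos ?in_itv /= ?normr_ge0 -?leNgt //.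
  by rewrite (le_trans _ tth).
by rewrite (le_trans tth).
Qed.

Lemma norm_cos_le_cos th t : 0 <= th -> th <= t -> t <= pi - th ->
  `|cos t| <= cos th.
Proof.
move=> th0 tht tpi; rewrite ler_norml; apply/andP; split.
  rewrite lerNl -cosN -cosDpi addrC.
  by apply: cos_ge_cos; [lra|rewrite ger0_norm; lra].
by apply: cos_ge_cos; [lra|rewrite ger0_norm; lra].
Qed.

Lemma switch_angleP r : 0 <= r ->
  [/\ 0 <= switch_angle r, switch_angle r < pi / 2 &
      cos (switch_angle r) = switch_cos r].
Proof.
move=> r0; have [k0 k1 _] := switch_cosP r0.
have kB : -1 <= switch_cos r <= 1 by rewrite k1 andbT; lra.
have [/andP[t0 tpi] ct] := acos_def kB.
rewrite /switch_angle -/(switch_cos r); split => //.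
rewrite ltNge; apply/negP => h.
have : cos (acos (switch_cos r)) <= cos (pi / 2).
  by apply: cos_ge_cos => //; rewrite ger0_norm // divr_ge0 ?pi_ge0.
by rewrite ct cos_pihalf leNgt k0.
Qed.

End Angles.

Lemma mem_supporting_line (R : realType) (WA : set R[i]) (t l : R) (p : R * R) :
  sup [set complex.Re (Num.conj (cos t +i* sin t)%C * z) | z in WA] = l ->
  p.1 * cos t + p.2 * sin t = l -> planar (supporting_line WA t) p.
Proof.
move=> supE pl; rewrite /planar /supporting_line /= supE.
(* The coordinate along the line is the imaginary part of [p] rotated by [- t]. *)
exists (p.2 * cos t - p.1 * sin t) => //.
apply/eqP; rewrite eq_complex /= -pl; apply/andP; split; apply/eqP.
  transitivity (p.1 * (cos t ^+ 2 + sin t ^+ 2)); first by ring.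
  by rewrite cos2Dsin2 mulr1.
transitivity (p.2 * (cos t ^+ 2 + sin t ^+ 2)); first by ring.
by rewrite cos2Dsin2 mulr1.
Qed.

(** The supremum is approached by the values [tau * l] as [tau] tends to 1, without being
    attained. *)
Lemma sup_support (R : realType) (WA : set R[i]) (t l : R) (p : R * R) :
  (forall q, planar WA q -> q.1 * cos t + q.2 * sin t < l) ->
  (forall tau, 0 <= tau -> tau < 1 -> planar WA (tau * p.1, tau * p.2)) ->
  p.1 * cos t + p.2 * sin t = l ->
  sup [set complex.Re (Num.conj (cos t +i* sin t)%C * z) | z in WA] = l.
Proof.
move=> W_lt W_scale pl; set A := [set _ | _ in _].
have Aub : ubound A l.
  move=> _ [[x y] Wz <-]; have := W_lt (x, y) Wz; rewrite /=; lra.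
have A_scale tau : 0 <= tau -> tau < 1 -> A (tau * l).
  move=> t0 t1; exists (tau * p.1 +i* (tau * p.2))%C; first exact: (W_scale tau).
  by rewrite -pl /=; ring.
have A0 : A !=set0 by exists (0 * l); apply: A_scale.
have As tau : 0 <= tau -> tau < 1 -> tau * l <= sup A.
  by move=> t0 t1; apply: ub_le_sup; [exists l|apply: A_scale].
have s0 : 0 <= sup A by have := As 0 (lexx 0) ltr01; rewrite mul0r.
apply/eqP; rewrite eq_le ge_sup //= leNgt; apply/negP => sl.
have l0 : 0 < l by apply: le_lt_trans sl.
(* If [sup A < l], the midpoint of [sup A / l] and 1 is a factor below 1 whose product with [l]
   exceeds the supremum. *)
have := As ((sup A / l + 1) / 2).
have : sup A / l < 1 by rewrite ltr_pdivrMr // mul1r.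
have : 0 <= sup A / l by rewrite divr_ge0 // ltW.
have : (sup A / l + 1) / 2 * l = (sup A + l) / 2 by field; rewrite gt_eqF.
move=> -> d0 d1 /(_ _ _); have := sl; lra.
Qed.

(** Starting the turn at [- th] lets the closed path begin at a switching point. *)
Lemma angle_turn (R : realType) (th t : R) : exists2 u,
  0 <= u <= 1 & exists t', [/\ t' = pi *+ 2 * u - th, cos t' = cos t & sin t' = sin t].
Proof.
have [t' [t0 t1 ct st]] := angle_reduction (t + th).
have p0 : 0 < pi *+ 2 :> R by rewrite pmulrn_lgt0 ?pi_gt0.
exists (t' / (pi *+ 2)).
  by apply/andP; split; [rewrite divr_ge0 // ltW|rewrite ler_pdivrMr // mul1r ltW].
exists (t' - th); split; first by rewrite mulrC divfK ?gt_eqF.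
  by rewrite cosB ct st -cosB addrK.
by rewrite sinB ct st -sinB addrK.
Qed.

Theorem theorem1 (R : realType) (H : completeNormedModType R[i])
    (dot : {dot H for Num.conj}) (dot_norm : hilbert_norm dot)
    (e : nat -> H) (e_basis : orthonormal_basis dot e)
    (S Sadj : {linear H -> H}) (S_shift : right_shift e S)
    (S_adj : adjoint dot S Sadj) (a : R[i]) :
  let r : R := ComplexField.Normc.normc a / 2 in
  let A : H * H -> H * H := foguel Sadj S (fun x => a *: x) in
  let WA : set R[i] := numerical_range (dot_sum dot) A in
  let W : set (R * R) := planar WA in
  let line (theta : R) : set (R * R) := planar (supporting_line WA theta) in
  let theta0 : R := switch_angle r in
  symmetric_wrt_axes W /\
  exists (gamma : R -> R * R) (t1 t2 t3 : R),
    let right := gamma @` `[0, t1] in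
    let top := gamma @` `[t1, t2] in
    let left := gamma @` `[t2, t3] in
    let bottom := gamma @` `[t3, 1] in
    [/\ simple_closed_path gamma,
        gamma @` `[0, 1] = boundary W,
        [/\ 0 <= t1, t1 <= t2, t2 <= t3 & t3 <= 1],
        [/\ right `<=` circle (1, 0) r /\ bounded_on_right W right,
            left `<=` circle (-1, 0) r /\ bounded_on_left W left,
            top `<=` foguel_curve r /\ bounded_above W top &
            bottom `<=` foguel_curve r /\ bounded_below W bottom] &
        [/\ line (- theta0) (gamma 0),
            line theta0 (gamma t1),
            line (pi - theta0) (gamma t2) &
            line (theta0 - pi) (gamma t3)]].
Proof.
move=> r A WA W line theta0.
have r0 : 0 <= r by rewrite divr_ge0 // normc_ge0.
have [px [py bm]] := boundary_map_exists r0.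
have W_lt p : W p -> forall t, p.1 * cos t + p.2 * sin t < foguel_support r t.
  by move=> Wp t; exact: (numerical_range_lt e_basis S_shift S_adj Wp t).
have W_lt' p : W p -> forall t, p.1 * cos t + p.2 * sin t < px t * cos t + py t * sin t.
  by move=> Wp t; rewrite (bm_supp bm); exact: W_lt.
have W_scale t tau : 0 <= tau -> tau < 1 -> W (tau * px t, tau * py t).
  move=> t0 t1; have [c [p [c1 p1 hy /= ->]]] := bm_ellipses bm t.
  exact: (ellipse_sub_range e_basis S_shift S_adj c1 p1 hy t0 t1).
have h_max t t' : px t' * cos t + py t' * sin t <= px t * cos t + py t * sin t.
  rewrite (bm_supp bm); exact: (ellipses_le_support t r0 (bm_ellipses bm t')).
have h_ge1 t : 1 <= px t * cos t + py t * sin t.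
  by rewrite (bm_supp bm) foguel_support_ge1.
have hW p : W p <-> forall t, p.1 * cos t + p.2 * sin t < foguel_support r t.
  rewrite (W_halfplanes (bm_contx bm) (bm_conty bm) (bm_ext bm) h_max h_ge1
    W_lt' W_scale).
  by split=> h t; have := h t; rewrite (bm_supp bm).
have hB p : boundary W p <-> exists t, p = (px t, py t).
  exact: (boundary_W (bm_contx bm) (bm_conty bm) (bm_ext bm) h_max h_ge1
    W_lt' W_scale).
split.
  (* The reflections in the axes act on normal angles by [- t] and [pi - t], and both preserve the
     support function. *)
  split=> x y /hW h; apply/hW => t /=.
    by have := h (- t); rewrite foguel_supportN cosN sinN /=; lra.
  have := h (pi - t); rewrite foguel_support_piB [pi - t]addrC cosDpi sinDpi.
  by rewrite cosN sinN /=; lra.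
have [th0 thpi cth] := switch_angleP r0.
rewrite -/theta0 in th0 thpi cth.
have pi0 := pi_gt0 R; have tpi0 : 0 < pi *+ 2 :> R by rewrite mulrn_wgt0.
have [k0 k1 kE] := switch_cosP r0.
(* One turn of the normal angle from [- theta0]. The arcs change at [theta0], [pi - theta0] and
   [pi + theta0], reached at [q], [1 / 2] and [1 / 2 + q]. *)
pose ang (u : R) := pi *+ 2 * u - theta0.
pose gamma u := (px (ang u), py (ang u)).
pose q := theta0 / pi.
have qpi : q * pi = theta0 by rewrite divfK // gt_eqF.
have q0 : 0 <= q by rewrite divr_ge0 // ltW.
have q1 : q <= 1 / 2 by rewrite ler_pdivrMr //; lra.
have ang_le u v : u <= v -> ang u <= ang v.
  by move=> uv; rewrite lerD2r ler_wpM2l // mulrn_wge0 // ltW.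
have ang0 : ang 0 = - theta0 by rewrite /ang mulr0 add0r.
have angq : ang q = theta0 by rewrite /ang -qpi; ring.
have angh : ang (1 / 2) = pi - theta0 by rewrite /ang; field.
have angh' : ang (1 / 2 + q) = pi + theta0 by rewrite /ang -qpi; field.
have ang1 : ang 1 = pi *+ 2 - theta0 by rewrite /ang mulr1.
exists gamma, q, (1 / 2), (1 / 2 + q).
have cap u : - theta0 <= ang u <= theta0 -> switch_cos r <= cos (ang u).
  by rewrite -ler_norml -cth; apply: cos_ge_cos; lra.
have capl u : pi - theta0 <= ang u <= pi + theta0 -> cos (ang u) <= - switch_cos r.
  move=> hu; have : switch_cos r <= cos (ang u - pi).
    rewrite -cth; apply: cos_ge_cos; first lra.
    by rewrite ler_norml; lra.
  by move=> h; rewrite -[ang u](subrK pi) cosDpi lerN2.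
have topc u : theta0 <= ang u <= pi - theta0 ->
    `|cos (ang u)| <= switch_cos r /\ 0 <= sin (ang u).
  move=> /andP[h1 h2]; rewrite -cth; split; first exact: norm_cos_le_cos.
  by apply: sin_ge0_pi; lra.
have botc u : pi + theta0 <= ang u <= pi *+ 2 - theta0 ->
    `|cos (ang u)| <= switch_cos r /\ sin (ang u) <= 0.
  move=> /andP[h1 h2]; rewrite -[ang u](subrK pi) cosDpi sinDpi normrN -cth oppr_le0.
  by split; [apply: norm_cos_le_cos|apply: sin_ge0_pi]; lra.
have line_gamma t u : cos t = cos (ang u) -> sin t = sin (ang u) -> line t (gamma u).
  move=> ct st; have [ex ey] := bm_ext bm ct st.
  have gE : gamma u = (px t, py t) by rewrite /gamma ex ey.
  rewrite gE; apply: (@mem_supporting_line _ _ _ (foguel_support r t)).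
    apply: (@sup_support _ _ _ _ (px t, py t)) => /=; last exact: (bm_supp bm).
      by move=> p Wp; exact: W_lt.
    exact: W_scale.
  exact: (bm_supp bm).
have itvE (u v : R) w : `[u, v]%classic w -> ang u <= ang w <= ang v.
  by rewrite /= in_itv /= => /andP[h1 h2]; rewrite !ang_le.
split.
- split.
  + apply: continuous_subspaceT => u.
    have hang : {for u, continuous ang}.
      by apply: cvgB; [apply: cvgM; [exact: cvg_cst|exact: cvg_id]|exact: cvg_cst].
    have hx : px (ang v) @[v --> u] --> px (ang u).
      by apply: continuous_comp => //; exact: (bm_contx bm).
    have hy : py (ang v) @[v --> u] --> py (ang u).
      by apply: continuous_comp => //; exact: (bm_conty bm).
    exact: (cvg_pair hx hy).
  + rewrite /gamma; have [|| -> ->//] := bm_ext bm (t := ang 0) (t' := ang 1).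
      by rewrite ang0 ang1 addrC cosD2pi.
    by rewrite ang0 ang1 addrC sinD2pi.
  + move=> u v; rewrite !in_itv /= => /andP[u0 u1] /andP[v0 v1] [ex ey].
    have [ce se] := bm_inj bm ex ey.
    have : ang u = ang v.
      apply: cos_sin_inj => //.
      rewrite (_ : ang u - ang v = pi *+ 2 * (u - v)); last by rewrite /ang; ring.
      rewrite normrM gtr0_norm //.
      have uv : `|u - v| < 1 by rewrite ltr_norml; lra.
      rewrite -subr_gt0 (_ : _ - _ = pi *+ 2 * (1 - `|u - v|)); last by ring.
      by rewrite mulr_gt0 ?subr_gt0.
    rewrite /ang => /addIr /mulfI; apply.
    by rewrite gt_eqF.
- apply/seteqP; split=> p.
    by move=> [u _ <-]; apply/hB; exists (ang u).
  move/hB => [t ->]; have [u u01 [t' [tE ct st]]] := angle_turn theta0 t.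
  exists u; first by rewrite /= in_itv.
  by rewrite /gamma /ang -tE; have [-> ->] := bm_ext bm ct st.
- by split=> //; lra.
- split.
  + split=> [_ [u /itvE hu <-]|p _ Wp [u /itvE hu <-] /= pE].
      rewrite ang0 angq in hu; have ck := cap _ hu.
      rewrite /circle /=; have [|-> ->] := bm_cap bm (t := ang u).
        rewrite -switch_cos_cap //; exact: le_trans ck (ler_norm _).
      rewrite gtr0_sg; last by lra.
      rewrite addrAC subrr add0r subr0 !exprMn -mulrDr.
      by rewrite cos2Dsin2 mulr1.
    rewrite ang0 angq in hu; have ck := cap _ hu.
    (* With equal ordinates, the strict support inequality compares the abscissas multiplied by a
       positive cosine. *)
    have := W_lt' _ Wp (ang u); rewrite pE ltrD2r ltr_pM2r; [exact: ltW|lra].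
  + split=> [_ [u /itvE hu <-]|p _ Wp [u /itvE hu <-] /= pE].
      rewrite angh angh' in hu; have ck := capl _ hu.
      rewrite /circle /=; have [|-> ->] := bm_cap bm (t := ang u).
        by rewrite -switch_cos_cap // -normrN; apply: le_trans (ler_norm _); lra.
      rewrite ltr0_sg; last by lra.
      rewrite addrAC subrr add0r subr0 !exprMn -mulrDr.
      by rewrite cos2Dsin2 mulr1.
    rewrite angh angh' in hu; have ck := capl _ hu.
    have := W_lt' _ Wp (ang u); rewrite pE ltrD2r ltr_nM2r; [exact: ltW|lra].
  + split=> [_ [u /itvE hu <-]|p _ Wp [u /itvE hu <-] /= pE].
      rewrite angq angh in hu; have [ck _] := topc _ hu.
      by apply: (bm_top bm); rewrite -switch_cos_top.
    rewrite angq angh in hu; have [_ sk] := topc _ hu.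
    have := W_lt' _ Wp (ang u); rewrite pE ltrD2l.
    (* If the sine is 0, equal abscissas contradict the strict support inequality, so there is no
       such point of [W]. *)
    move: sk; rewrite le_eqVlt => /predU1P[<-|sk]; first by rewrite !mulr0 ltxx.
    by rewrite ltr_pM2r // => /ltW.
  + split=> [_ [u /itvE hu <-]|p _ Wp [u /itvE hu <-] /= pE].
      rewrite angh' ang1 in hu; have [ck _] := botc _ hu.
      by apply: (bm_top bm); rewrite -switch_cos_top.
    rewrite angh' ang1 in hu; have [_ sk] := botc _ hu.
    have := W_lt' _ Wp (ang u); rewrite pE ltrD2l.
    move: sk; rewrite le_eqVlt => /predU1P[->|sk]; first by rewrite !mulr0 ltxx.
    by rewrite ltr_nM2r // => /ltW.
- split; apply: line_gamma.
  + by rewrite ang0.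
  + by rewrite ang0.
  + by rewrite angq.
  + by rewrite angq.
  + by rewrite angh.
  + by rewrite angh.
  (* The angles [pi + theta0] and [theta0 - pi] differ by a full turn. *)
  + by rewrite angh' [pi + _]addrC -[in RHS](subrK pi theta0) -addrA -mulr2n cosD2pi.
  + by rewrite angh' [pi + _]addrC -[in RHS](subrK pi theta0) -addrA -mulr2n sinD2pi.
Qed.
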